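(* Let $X,Y\in\mathcal{A}$ be random variables that are non-degenerate, free, and such that $S=X+Y$ is strictly positive. Let $Z=S^{-1/2}XS^{-1/2}$. If $Z$ and $S$ are free, then $X$ and $Y$ have free Poisson type laws. Moreover, $\tau(X)>0$ and the centered standardized variable $(X-\tau(X)1)/\sqrt{\mathrm{Var}(X)}$ has the free Meixner law $\mu_{a,0}$ with $a=\sqrt{\mathrm{Var}(X)}/\tau(X)$.
   Context: $\mathcal{A}$ is a von Neumann algebra with unit $1$ and a normal faithful tracial state $\tau$. A random variable is a self-adjoint element of $\mathcal{A}$; its law is the unique probability measure $\mu$ on $\mathbb{R}$ with $\tau(X^n)=\int x^n\,d\mu$ for all $n\ge0$. It is non-degenerate if it is not a multiple of $1$; $\mathrm{Var}(X)=\tau(X^2)-\tau(X)^2$. It is strictly positive if its law is supported on $[c,d]$ for some $c>0$. Freeness is in the sense of Voiculescu with respect to $\tau$. For $a\in\mathbb{R}$, the free Meixner law $\mu_{a,0}$ is the probability measure on $\mathbb{R}$ (mean $0$, variance $1$) with Cauchy–Stieltjes transform $$\int_{\mathbb{R}}\frac{1}{z-y}\,\mu_{a,0}(dy)=\frac{z+a-\sqrt{(z-a)^2-4}}{2(az+1)},$$ with the branch of the square root behaving like $z$ as $z\to\infty$; equivalently its $R$-transform $\sum_{k\ge0}R_{k+1}z^k$ ($R_k$ are the free cumulants) is $z/(1-az)$. The free Poisson law of mean $m>0$ is the law with $R$-transform $m/(1-z)$; a free Poisson type law is the law of an affine function of a free Poisson random variable (the non-degenerate ones are the affine images of $\mu_{a,0}$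 with $a\ne0$). *)

(* Defs.v *)
From HB Require Import structures.
From mathcomp Require Import all_boot all_order all_algebra.
From mathcomp Require Import sesquilinear complex.
From mathcomp Require Import all_classical all_reals all_analysis.

Set Implicit Arguments.
Unset Strict Implicit.
Unset Printing Implicit Defensive.

Import Order.TTheory GRing.Theory Num.Theory.
Import numFieldNormedType.Exports.

Local Open Scope classical_set_scope.
Local Open Scope complex_scope.
Local Open Scope ring_scope.

Section VonNeumannAlgebra.
Context {R : realType} {H : completeNormedModType R[i]}.
Implicit Types (dot : {dot H for (@Num.conj R[i])}) (M : set (H -> H)).

(* Together with the completeness of H, this makes (H, dot) a Hilbert space;
   dot is linear in its first argument and conjugate-linear in the second. *)
Definition norm_from_dot dot := forall u : H, `|u| ^+ 2 = dot u u.

Definition bounded_operator (f : H -> H) := linear f /\ continuous f.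

Definition commutant M : set (H -> H) :=
  [set f | bounded_operator f /\ forall g, M g -> f \o g = g \o f].

Context {A : algType R[i]}.
Implicit Types (star : A -> A) (rep : A -> H -> H).

(* A is identified through rep with a unital *-subalgebra of B(H) that equals
   its own bicommutant; star is the transported adjoint. *)
Record von_neumann_algebra dot star rep : Prop := VonNeumannAlgebra {
  vna_hilbert : norm_from_dot dot ;
  vna_bounded : forall a, bounded_operator (rep a) ;
  vna_inj : injective rep ;
  vna_linear : forall (k : R[i]) a b u,
    rep (k *: a + b) u = k *: rep a u + rep b u ;
  vna_one : rep 1 = id ;
  vna_mul : forall a b, rep (a * b) = rep a \o rep b ;
  vna_star : forall a u v, dot (rep a u) v = dot u (rep (star a) v) ;
  vna_bicommutant : commutant (commutant (range rep)) = range rep }.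

Definition self_adjoint star (a : A) := star a = a.

Definition op_ge0 dot rep (a : A) := forall u : H, 0 <= dot (rep a u) u.

Definition op_le dot rep (a b : A) := op_ge0 dot rep (b - a).

Definition sa_lub dot star rep (D : set A) (s : A) :=
  [/\ self_adjoint star s,
      forall d, D d -> op_le dot rep d s
    & forall b, self_adjoint star b ->
        (forall d, D d -> op_le dot rep d b) -> op_le dot rep s b].

Definition upward_directed dot rep (D : set A) :=
  D !=set0 /\ forall a b, D a -> D b ->
    exists c, [/\ D c, op_le dot rep a c & op_le dot rep b c].

Record normal_faithful_tracial_state dot star rep (tau : {scalar A}) : Prop :=
  NormalFaithfulTracialState {
  state_one : tau 1 = 1 ;
  state_ge0 : forall a, 0 <= tau (star a * a) ;
  state_faithful : forall a, tau (star a * a) = 0 -> a = 0 ;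
  state_tracial : forall a b, tau (a * b) = tau (b * a) ;
  (* tau s is the supremum of tau over D; that it is an upper bound follows
     from positivity. *)
  state_normal : forall (D : set A) s,
    (forall d, D d -> self_adjoint star d) -> upward_directed dot rep D ->
    sa_lub dot star rep D s ->
    forall r : R[i], (forall d, D d -> tau d <= r) -> tau s <= r }.

(* t = s^(-1/2): the positive square root of the inverse of s. *)
Definition is_inv_sqrt dot rep (s t : A) :=
  [/\ op_ge0 dot rep t, t ^+ 2 * s = 1 & s * t ^+ 2 = 1].

End VonNeumannAlgebra.

Section RandomVariables.
Context {R : realType} {A : algType R[i]}.
Implicit Types (tau : {scalar A}) (x y : A).

Definition nondegenerate_rv x := ~ exists k : R[i], x = k%:A.

(* For self-adjoint x, tau x and the variance are real. *)
Definition mean tau x : R := complex.Re (tau x).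

Definition variance_rv tau x : R := mean tau (x ^+ 2) - mean tau x ^+ 2.

Definition standardize tau x : A :=
  ((Num.sqrt (variance_rv tau x))^-1)%:C *: (x - (mean tau x)%:C%:A).

Definition free_subsets (I : Type) tau (B : I -> set A) :=
  forall (n : nat) (i : nat -> I) (a : nat -> A), (0 < n)%N ->
    (forall j, (j < n)%N -> B (i j) (a j) /\ tau (a j) = 0) ->
    (forall j, (j.+1 < n)%N -> i j <> i j.+1) ->
    tau (\prod_(j < n) a j) = 0.

Definition generated_algebra x : set A := range (horner_alg x).

(* On self-adjoint elements generated_algebra is the unital *-algebra
   generated, so this is Voiculescu's freeness of random variables. *)
Definition free_rv tau x y :=
  free_subsets tau (fun b : bool => generated_algebra (if b then x else y)).

Definition is_law tau x (mu : probability (measurableTypeR R) R) :=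
  forall n : nat,
    mu.-integrable setT (EFin \o (fun t : R => t ^+ n)) /\
    tau (x ^+ n) = (\int[mu]_t (t ^+ n))%:C.

Definition strictly_positive tau x :=
  exists mu, is_law tau x mu /\
    exists c d : R, 0 < c /\ mu `[c, d]%classic = 1%E.

End RandomVariables.

Section Laws.
Context {R : realType}.
Local Notation law := (probability (measurableTypeR R) R).
Implicit Types (mu nu : law).

Definition cauchy_transform mu (z : R[i]) : R[i] :=
  (\int[mu]_t complex.Re (z - t%:C)^-1) +i* (\int[mu]_t complex.Im (z - t%:C)^-1).

(* sqrtc is the principal square root, and off the real axis the product
   sqrtc (z - a - 2) * sqrtc (z - a + 2) is the square root of (z - a)^2 - 4
   that behaves like z at infinity. *)
Definition free_meixner (a : R) mu :=
  forall z : R[i], complex.Im z != 0 ->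
    cauchy_transform mu z =
      (z + a%:C - sqrtc (z - a%:C - 2) * sqrtc (z - a%:C + 2))
      / (2 * (a%:C * z + 1)).

Definition noncrossing (n : nat) (P : {set {set 'I_n}}) : bool :=
  finset.partition P [set: 'I_n]%SET &&
  [forall B in P, forall C in P, (B != C) ==>
    ~~ [exists i in B, exists j in C, exists k in B, exists l in C,
         (i < j < k)%N && (k < l)%N]].

(* The moment-cumulant formula, which determines kappa k for k >= 1. *)
Definition free_cumulants mu (kappa : nat -> R) :=
  forall n : nat,
    mu.-integrable setT (EFin \o (fun t : R => t ^+ n)) /\
    \int[mu]_t (t ^+ n) =
      \sum_(P : {set {set 'I_n}} | noncrossing P)
        \prod_(B in P) kappa #|B|.

Definition has_R_transform mu (f : R -> R) :=
  exists2 kappa, free_cumulants mu kappa &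
    \forall z \near (0 : R),
      series (fun k => kappa k.+1 * z ^+ k) @ \oo --> f z.

Definition free_poisson (m : R) mu :=
  0 < m /\ has_R_transform mu (fun z => m / (1 - z)).

Definition free_poisson_type mu :=
  exists m nu (alpha beta : R), free_poisson m nu /\
    forall B : set R, measurable B ->
      mu B = nu ((fun t => alpha * t + beta) @^-1` B).

End Laws.

(* Main.v *)
(* Conjugating by S^(1/2) turns (X, S) into (Z S, S) under the trace, so freeness of Z and S
   gives tau(X p) = b tau(S p) and tau(X^2 p) = b^2 tau(S^2 p) + g tau(S p) for all p in the
   algebra of S. Let r_n and rho_n be the free cumulants of order n + 1 of X and of S = X + Y.
   Haagerup's alternating-product form of the resolvent of X + Y, read coefficient by
   coefficient, provides elements q_n of the algebra of S with tau(X q_n) = r_n,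
   tau(S q_n) = rho_n, tau(X^2 q_n) = r_(n+1) + sum_k r_k r_(n-k), and likewise for S^2.
   Inserting p = q_n gives r_n = b rho_n and b (1 - b) rho_(n+1) = g rho_n: the cumulants are
   geometric, and positivity of the variances of X and Y yields 0 < b < 1.
   Geometric cumulants m c^n amount to a quadratic recurrence for the moments, which is also
   satisfied by the sum of (m / c)^(number of blocks) over noncrossing partitions and by the
   Marchenko-Pastur law. The latter is written as the image, under the angle x in [0, pi], of
   t = 1 + q^2 + 2 q cos x with q^2 = m / c, plus an atom at 0. Its total mass and its Cauchy
   transform both come from the integral of sin^2 x / (1 - 2 w cos x + w^2), |w| < 1. *)
Require Import Defs.
From HB Require Import structures.
From mathcomp Require Import all_boot all_order all_algebra ring lra.
From mathcomp Require Import boolp.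

Import Order.TTheory GRing.Theory Num.Theory.

Local Open Scope ring_scope.

(** Freeness speaks about polynomials in [S], and [S^(1/2)] need not be one; traciality and
    commutation with [S] are what remove it, after which the argument stays with coefficients until
    a measure has to be exhibited. The conclusion asks for three descriptions of one law that do not
    meet directly: the moments of [X], a sum over noncrossing partitions, and a Cauchy transform.
    The quadratic recurrence determines all moments from the first one on, so it links the first
    two; the third is computed on the explicit measure. Origin of the constants: if the free
    cumulant of order n + 1 of [X] is [m c^n], then [tau X = m] and [Var X = c m], and [X] is
    distributed like [c t] with [t] free Poisson of mean [q^2 = m / c]. Hence [sqrt (Var X) = c q]
    and [tau X = c q^2], so [a = 1 / q], and the standardized variable becomes [t / q - q]. The
    cumulants of [Y] are those of [S] times [1 - b], so the scale [c] is common to [X] and [Y]. *)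

Section AppellMoments.
Variables (K : comNzRingType) (f : nat -> nat -> K).
Hypothesis f0 : forall n, f 0 n = (n == 0%N)%:R.

(* For f m n = tau(X^m a_n), with a_n the free Appell polynomials of X, the recurrence in the
   hypothesis says that the free cumulant of order k + 1 is mu c^k. *)
Lemma geometric_appell_moments (mu c : K) :
  (forall m n, f m.+1 n =
     f m n.+1 + \sum_(k < n.+1) mu * c ^+ k * f m (n - k)%N) ->
  forall n, f n.+1 0 =
     mu * f n 0 + c * \sum_(i < n) f i.+1 0 * f (n.-1 - i)%N 0.
Proof.
move=> fS.
(* The recurrence in [m] raises [n], so all [n] are treated at once. The last summand, void at
   [n = 0], comes from the tail of the geometric sum: the terms with [k > 0] at [n] are [c] times
   the whole sum at [n - 1]. *)
suff H m n : f m.+1 n = mu * f m n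
    + c * (\sum_(i < m) f i.+1 0 * f (m.-1 - i)%N n)
    + c * (if n is n'.+1 then f m.+1 n' else 0).
  by move=> n; rewrite H mulr0 addr0.
elim: m n => [n|m IH n].
  rewrite big_ord0 mulr0 addr0 fS !f0 add0r.
  case: n => [|n]; first by rewrite big_ord1 subnn f0 expr0 !mulr1 mulr0 addr0.
  rewrite fS f0 add0r mulr0 add0r big_ord_recr /= subnn f0 mulr1.
  rewrite big1 => [|i _]; last by rewrite f0 (subSn (ltn_ord i : (i <= n)%N)) /= mulr0.
  rewrite big_ord_recr /= subnn f0 mulr1 big1 => [|i _]; last first.
    by rewrite f0 -(subnSK (ltn_ord i)) /= mulr0.
  by rewrite !add0r exprS mulrCA.
have -> : f m.+2 n = mu * f m.+1 n
    + c * (\sum_(i < m) f i.+1 0 * f (m - i)%N n)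
    + c * (f m.+1 n + if n is n'.+1 then
        \sum_(k < n'.+1) mu * c ^+ k * f m.+1 (n' - k)%N else 0).
  rewrite fS IH; under [X in _ + X = _]eq_bigr => k _ do rewrite IH !mulrDr.
  rewrite !big_split /= (fS m n).
  have -> : \sum_(i < n.+1) mu * c ^+ i * (mu * f m (n - i)%N) =
            mu * \sum_(i < n.+1) mu * c ^+ i * f m (n - i)%N.
    by rewrite mulr_sumr; apply: eq_bigr => i _; rewrite mulrCA.
  have -> : \sum_(i < m) f i.+1 0 * f (m - i)%N n =
      \sum_(i < m) f i.+1 0 * f (m.-1 - i)%N n.+1 +
      \sum_(k < n.+1) mu * c ^+ k *
         \sum_(i < m) f i.+1 0 * f (m.-1 - i)%N (n - k)%N.
    under [X in _ + X]eq_bigr => k _ do rewrite mulr_sumr.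
    rewrite exchange_big -big_split; apply: eq_bigr => i _ /=.
    have -> : (m - i = (m.-1 - i).+1)%N.
      by case: m i {IH} => [[]//|m] i /=; rewrite subSn // -ltnS.
    rewrite (fS (m.-1 - i)%N) mulrDr mulr_sumr; congr (_ + _).
    by apply: eq_bigr => k _; rewrite mulrCA.
  have -> : \sum_(i < n.+1) mu * c ^+ i *
       (c * match (n - i)%N with 0%N => 0 | n'.+1 => f m.+1 n' end) =
     c * match n with 0%N => 0 | n'.+1 =>
        \sum_(k < n'.+1) mu * c ^+ k * f m.+1 (n' - k)%N end.
    case: n => [|n]; first by rewrite big_ord1 !mulr0.
    rewrite big_ord_recr /= subnn !mulr0 addr0 mulr_sumr.
    by apply: eq_bigr => i _; rewrite subSn 1?mulrCA // -ltnS.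
  have -> : \sum_(i < n.+1) mu * c ^+ i *
       (c * (\sum_(i0 < m) f i0.+1 0 * f (m.-1 - i0)%N (n - i)%N)) =
     c * \sum_(i < n.+1) mu * c ^+ i *
       (\sum_(i0 < m) f i0.+1 0 * f (m.-1 - i0)%N (n - i)%N).
    by rewrite mulr_sumr; apply: eq_bigr => i _; rewrite mulrCA.
  set C := \sum_(i < n.+1) mu * c ^+ i * f m (n - i)%N.
  set D := \sum_(i < n.+1) (mu * c ^+ i * \sum_(i0 < m) _).
  set E := (match n with 0%N => _ | _ => _ end).
  by ring. 
rewrite big_ord_recr /= subnn f0.
case: n => [|n]; first by rewrite mulr1 addr0 mulr0 addr0; ring.
by rewrite /= mulr0 addr0 (fS m.+1 n).
Qed.

(* Same reading of f, for free cumulants r0, r1, 0, 0, ... *)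
Lemma semicircular_appell_moments (r0 r1 : K) :
  (forall m n, f m.+1 n =
     f m n.+1 + r0 * f m n + r1 * (if n is n'.+1 then f m n' else 0)) ->
  forall n, f n.+1 0 = r0 * f n 0 + r1 * \sum_(i < n) f i 0 * f (n.-1 - i)%N 0.
Proof.
move=> fS.
(* First-passage decomposition: [f m n] is the weight of the paths of [m] steps from height [n] to
   0, with steps up (weight 1), level ([r0]) and down ([r1]). The first descent from [n + 1] to [n]
   follows a path of length [i] that returns to its starting height without going below it. *)
suff H m n : f m n.+1 = r1 * \sum_(i < m) f i 0 * f (m.-1 - i)%N n.
  by move=> n; rewrite fS H mulr0 addr0 addrC.
elim: m n => [n|m IH n]; first by rewrite f0 big_ord0 mulr0.
rewrite big_ord_recr /= subnn f0.
have -> : \sum_(i < m) f i 0 * f (m - i)%N n =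
   \sum_(i < m) f i 0 * f (m.-1 - i)%N n.+1 +
   r0 * (\sum_(i < m) f i 0 * f (m.-1 - i)%N n) +
   r1 * (if n is n'.+1 then \sum_(i < m) f i 0 * f (m.-1 - i)%N n' else 0).
  have -> : (if n is n'.+1 then \sum_(i < m) f i 0 * f (m.-1 - i)%N n' else 0) =
     \sum_(i < m) f i 0 * (if n is n'.+1 then f (m.-1 - i)%N n' else 0).
    by case: n => // ; rewrite big1 // => i _; rewrite mulr0.
  rewrite !mulr_sumr -!big_split; apply: eq_bigr => i _ /=.
  have -> : (m - i = (m.-1 - i).+1)%N.
    by case: m i {IH} => [[]//|m] i /=; rewrite subSn // -ltnS.
  by rewrite (fS (m.-1 - i)%N); set E := (match n with 0%N => _ | _ => _ end); ring.
rewrite (fS m) !IH; set C := \sum_(i < m) f i 0 * f (m.-1 - i)%N n.+1.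
set D := \sum_(i < m) f i 0 * f (m.-1 - i)%N n.
case: n @C @D => [|n] C D /=; first by ring.
rewrite IH; set E := \sum_(i < m) f i 0 * f (m.-1 - i)%N n; by ring.
Qed.

End AppellMoments.

(** Multiplying the free Poisson law of mean [l] by the density [t] gives [l] times the semicircle
    law of mean [1 + l] and variance [l], whose moments obey the recurrence assumed for [w]. *)
Lemma free_poisson_moments_of_semicircular (K : comNzRingType) (l : K) (w m : nat -> K) :
  w 0 = 1 ->
  (forall n, w n.+1 =
     (1 + l) * w n + l * \sum_(i < n) w i * w (n.-1 - i)%N) ->
  m 0 = 1 -> (forall n, m n.+1 = l * w n) ->
  forall n, m n.+1 = l * m n + \sum_(i < n) m i.+1 * m (n.-1 - i)%N.
Proof.
move=> w0 wS m0 mS [|n]; first by rewrite big_ord0 addr0 m0 mS w0.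
rewrite big_ord_recr /= subnn m0 mulr1 !mS wS.
have -> : \sum_(i < n) m i.+1 * m (n - i)%N =
          l * (l * \sum_(i < n) w i * w (n.-1 - i)%N).
  rewrite !mulr_sumr; apply: eq_bigr => i _ /=.
  have -> : (n - i = (n.-1 - i).+1)%N.
    by case: n i => [[]//|n] i /=; rewrite subSn // -ltnS.
  by rewrite !mS; ring.
by ring.
Qed.

Lemma eq_quadratic_recurrence (K : comNzRingType) (l c : K) (m m' : nat -> K) :
  m 0 = m' 0 ->
  (forall n, m n.+1 = l * m n + c * \sum_(i < n) m i.+1 * m (n.-1 - i)%N) ->
  (forall n, m' n.+1 = l * m' n + c * \sum_(i < n) m' i.+1 * m' (n.-1 - i)%N) ->
  m =1 m'.
Proof.
move=> m0 mS mS' n; elim/ltn_ind: n => -[//|n] IH.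
rewrite mS mS' IH //; congr (_ + _ * _); apply: eq_bigr => i _.
by rewrite !IH // ltnS ?(leq_trans (leq_subr _ _)) // leq_pred.
Qed.

(** * Noncrossing partitions *)

Section NoncrossingPartitions.
Variable N : nat.
Implicit Types (D B C : {set 'I_N}) (P Q : {set {set 'I_N}}) (a x y : 'I_N).

Definition crossfree P : bool :=
  [forall B in P, forall C in P, (B != C) ==>
    ~~ [exists i in B, exists j in C, exists k in B, exists l in C,
         (i < j < k)%N && (k < l)%N]].

(** Subsets of one fixed ordinal are partitioned, so that a recursion can delete the least element
    without renumbering. For [D] the full set this unfolds to [noncrossing]. *)
Definition nc_partition D P : bool := finset.partition P D && crossfree P.

Lemma crossfreeP P :
  reflect (forall B C (i j k l : 'I_N), B \in P -> C \in P ->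
             i \in B -> j \in C -> k \in B -> l \in C ->
             (i < j)%N -> (j < k)%N -> (k < l)%N -> B = C)
          (crossfree P).
Proof.
apply: (iffP idP) => [H B C i j k l BP CP iB jC kB lC ij jk kl|H].
  apply/eqP; apply: contraT => BC.
  move/forall_inP/(_ B BP)/forall_inP/(_ C CP)/implyP/(_ BC) : H.
  move/negP; case; apply/exists_inP; exists i => //.
  apply/exists_inP; exists j => //; apply/exists_inP; exists k => //.
  by apply/exists_inP; exists l => //; rewrite ij jk.
apply/forall_inP => B BP; apply/forall_inP => C CP; apply/implyP => BC.
apply/negP => /exists_inP[i iB] /exists_inP[j jC] /exists_inP[k kB].
case/exists_inP => l lC /andP[/andP[ij jk] kl].
by move/eqP: BC; apply; exact: (H B C i j k l).
Qed.

Lemma partition_spec P D :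
  reflect [/\ forall B, B \in P -> exists y, y \in B,
              forall B y, B \in P -> y \in B -> y \in D,
              forall y, y \in D -> exists2 B, B \in P & y \in B
            & forall B C y, B \in P -> C \in P -> y \in B -> y \in C -> B = C]
          (finset.partition P D).
Proof.
apply: (iffP idP) => [pP|[P0 PD cP tP]].
  have [/eqP cP tP P0] := and3P pP; split.
  - by move=> B BP; apply/set0Pn; apply: contraNneq P0 => <-.
  - by move=> B y BP yB; rewrite -cP; apply/bigcupP; exists B.
  - by move=> y; rewrite -cP => /bigcupP[B]; exists B.
  - by move=> B C y BP CP yB yC; rewrite -(def_pblock tP BP yB) (def_pblock tP CP yC).
apply/and3P; split.
- apply/eqP/setP => y; apply/bigcupP/idP => [[B BP yB]|/cP[B]].
    exact: PD yB.
  by exists B.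
- apply/trivIsetP => B C BP CP; apply: contraNT => /pred0Pn[y /andP[yB yC]].
  by apply/eqP; exact: (tP B C y).
- by apply/negP => /P0[y]; rewrite inE.
Qed.

Section Decomposition.
Variables (D : {set 'I_N}) (a : 'I_N).
Hypotheses (aD : a \in D) (amin : forall y, y \in D -> (a <= y)%N).

Let a_lt y : y \in D :\ a -> (a < y)%N.
Proof.
rewrite !inE => /andP[ya /amin]; rewrite leq_eqVlt => /orP[/eqP e|//].
by move/eqP: ya; case; apply: val_inj.
Qed.

Lemma nc_partition_singleton Q : nc_partition (D :\ a) Q ->
  nc_partition D ([set a] |: Q) /\ [set a] \notin Q.
Proof.
case/andP => /partition_spec[Q0 QD cQ tQ] /crossfreeP xQ.
have aQ B : B \in Q -> a \notin B.
  by move=> BQ; apply/negP => /(QD _ _ BQ); rewrite !inE eqxx.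
split; last by apply/negP => /aQ; rewrite inE eqxx.
apply/andP; split.
  apply/partition_spec; split.
  - by move=> B /setU1P[->|/Q0//]; exists a; rewrite inE.
  - move=> B y /setU1P[->|BQ]; first by rewrite inE => /eqP ->.
    by move/(QD _ _ BQ); rewrite inE => /andP[].
  - move=> y yD; have [->|ya] := eqVneq y a.
      by exists [set a]; rewrite !inE eqxx.
    have [|B BQ yB] := cQ y; first by rewrite !inE ya.
    by exists B => //; rewrite inE BQ orbT.
  - move=> B C y /setU1P[->|BQ] /setU1P[->|CQ] //.
    + by rewrite inE => /eqP -> aC; move: (aQ _ CQ); rewrite aC.
    + by move=> aB; rewrite inE => /eqP ya; move: (aQ _ BQ); rewrite -ya aB.
    + exact: tQ.
apply/crossfreeP => B C i j k l /setU1P[->|BQ] /setU1P[->|CQ] //.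
- by rewrite !inE => /eqP -> _ /eqP -> _ aj /(ltn_trans aj); rewrite ltnn.
- by rewrite !inE => _ /eqP -> _ /eqP -> _ ak /(ltn_trans ak); rewrite ltnn.
- exact: xQ.
Qed.

Lemma nc_partition_del_singleton P : nc_partition D P -> [set a] \in P ->
  nc_partition (D :\ a) (P :\ [set a]).
Proof.
case/andP => /partition_spec[P0 PD cP tP] /crossfreeP xP aP.
apply/andP; split.
  apply/partition_spec; split.
  - by move=> B /setD1P[_ /P0].
  - move=> B y /setD1P[Ba BP] yB; rewrite !inE (PD _ _ BP yB) andbT.
    apply/eqP => ya; move/eqP: Ba; case.
    by apply: (tP _ _ a) => //; rewrite -?ya // inE.
  - move=> y /setD1P[ya /cP[B BP yB]]; exists B => //.
    rewrite !inE BP andbT; apply: contraNneq ya => Ba.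
    by move: yB; rewrite Ba inE.
  - by move=> B C y /setD1P[_ BP] /setD1P[_ CP]; exact: tP.
by apply/crossfreeP => B C i j k l /setD1P[_ BP] /setD1P[_ CP]; exact: xP.
Qed.

Section Next.
Variable x : 'I_N.
Hypothesis xD : x \in D :\ a.

Let Dlt := [set y in D :\ a | (y < x)%N].
Let Dge := [set y in D :\ a | (x <= y)%N].

(** As [a] is the least element of [D], this makes [x] the second smallest element of the block of
    [a]. *)
Definition next_in_block P :=
  exists B, [/\ B \in P, a \in B, x \in B &
                forall y, y \in B -> y != a -> (x <= y)%N].

Definition add_min B := if x \in B then a |: B else B.

Definition nc_join (Q : {set {set 'I_N}} * {set {set 'I_N}}) :=
  Q.1 :|: add_min @: Q.2.

(** The blocks strictly between [a] and [x] form the first component. In the second, deleting [a]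
    everywhere changes only the block of [x], so [add_min] knows where to restore it. *)
Definition nc_split P :=
  ([set B in P | B \subset Dlt],
   [set B :\ a | B : {set 'I_N} in [set B in P | ~~ (B \subset Dlt)]]).

(** A block that avoids [a] and meets both sides of [x] would cross the block of [a]:
    [a < z < x < y], with [a] and [x] in one block and [z] and [y] in the other. *)
Lemma nc_block_side P : nc_partition D P -> next_in_block P ->
  forall B y, B \in P -> a \notin B -> y \in B -> (x <= y)%N ->
  x \notin B /\ forall z, z \in B -> (x <= z)%N.
Proof.
move=> /andP[/partition_spec[P0 PD cP tP] /crossfreeP xP] [B0 [B0P aB0 xB0 _]].
move=> B y BP aB yB xy.
have xB : x \notin B.
  by apply/negP => xB; move: aB; rewrite (tP B B0 x) ?aB0.
split=> // z zB; rewrite leqNgt; apply/negP => zx.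
have BB : B0 = B.
  apply: (xP B0 B a z x y) => //.
    apply: a_lt; rewrite !inE (PD _ _ BP zB) andbT.
    by apply: contraNneq aB => <-.
  rewrite ltn_neqAle xy andbT; apply: contraNneq xB => xy'.
  by rewrite (val_inj xy' : x = y).
by rewrite -BB aB0 in aB.
Qed.

Lemma nc_splitK P : nc_partition D P -> next_in_block P ->
  nc_join (nc_split P) = P.
Proof.
move=> ncP nxP; have side := nc_block_side P ncP nxP.
have /andP[/partition_spec[P0 PD cP tP] _] := ncP.
have [B0 [B0P aB0 xB0 B0min]] := nxP.
have addK B : B \in P -> ~~ (B \subset Dlt) -> add_min (B :\ a) = B.
  move=> BP nB; have [aB|aB] := boolP (a \in B).
    rewrite (tP B B0 a) // /add_min !inE xB0 andbT.
    by rewrite (_ : x != a) ?setD1K //; case/setD1P: xD.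
  have -> : B :\ a = B.
    by apply/setP => y; rewrite !inE; case: eqP => // ->; rewrite (negbTE aB).
  have [y yB] := subsetPn nB; rewrite !inE (PD _ _ BP yB) andbT.
  rewrite negb_and negbK -leqNgt => /orP[/eqP ya|xy].
    by rewrite -ya yB in aB.
  by rewrite /add_min (negbTE (side B y BP aB yB xy).1).
apply/setP => B; apply/setUP/idP => [[|]|BP].
- by rewrite inE => /andP[].
- case/imsetP => C /imsetP[E]; rewrite inE => /andP[EP nE] -> ->.
  by rewrite addK.
- have [sB|nB] := boolP (B \subset Dlt); first by left; rewrite inE BP.
  right; rewrite -(addK B) //; apply: imset_f; apply: imset_f.
  by rewrite inE BP.
Qed.

Lemma nc_split_nc P : nc_partition D P -> next_in_block P ->
  nc_partition Dlt (nc_split P).1 /\ nc_partition Dge (nc_split P).2.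
Proof.
move=> ncP nxP; have side := nc_block_side P ncP nxP.
have /andP[/partition_spec[P0 PD cP tP] /crossfreeP xP] := ncP.
have [B0 [B0P aB0 xB0 B0min]] := nxP.
have xDlt : x \notin Dlt by rewrite !inE ltnn andbF.
have big B : B \in P -> ~~ (B \subset Dlt) ->
    forall y, y \in B :\ a -> y \in Dge.
  move=> BP nB y /setD1P[ya yB]; rewrite !inE ya (PD _ _ BP yB) /=.
  have [aB|aB] := boolP (a \in B).
    by apply: B0min => //; rewrite -(tP B B0 a).
  have [z zB] := subsetPn nB; rewrite !inE (PD _ _ BP zB) andbT.
  rewrite negb_and negbK -leqNgt => /orP[/eqP za|xz].
    by rewrite -za zB in aB.
  exact: (side B z BP aB zB xz).2.
have small B y : B \in P -> y \in B -> y \in Dlt -> B \subset Dlt.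
  move=> BP yB yl; apply: contraT => nB; move: yl.
  rewrite inE => /andP[/setD1P[ya yD] yx].
  have := big B BP nB y; rewrite !inE ya yB yD => /(_ isT) /=.
  by rewrite leqNgt yx.
split; apply/andP; split.
- apply/partition_spec; split.
  + by move=> B; rewrite inE => /andP[/P0].
  + by move=> B y; rewrite inE => /andP[_ /subsetP]; apply.
  + move=> y yl; have [|B BP yB] := cP y.
      by move: yl; rewrite !inE => /andP[/andP[]].
    by exists B => //; rewrite inE BP (small B y).
  + move=> B C y; rewrite !inE => /andP[BP _] /andP[CP _]; exact: tP.
- apply/crossfreeP => B C i j k l; rewrite !inE => /andP[BP _] /andP[CP _].
  exact: xP.
- apply/partition_spec; split.
  + move=> _ /imsetP[B + ->]; rewrite inE => /andP[BP nB].
    have [y yB ny] := subsetPn nB; have [ya|ya] := eqVneq y a; last first.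
      by exists y; rewrite !inE ya.
    exists x; rewrite !inE; case/setD1P: xD => -> _ /=.
    by rewrite (tP B B0 a) // -ya.
  + move=> _ y /imsetP[B + ->]; rewrite inE => /andP[BP nB]; exact: big.
  + move=> y yl; have [|B BP yB] := cP y.
      by move: yl; rewrite !inE => /andP[/andP[]].
    exists (B :\ a); last by move: yl; rewrite !inE yB andbT => /andP[/andP[]].
    apply: imset_f; rewrite inE BP /=; apply/subsetPn; exists y => //.
    by move: yl; rewrite !inE => /andP[_]; rewrite leqNgt => /negbTE ->; rewrite andbF.
  + move=> _ _ y /imsetP[B + ->] /imsetP[C + ->].
    rewrite !inE => /andP[BP _] /andP[CP _] /andP[_ yB] /andP[_ yC].
    by rewrite (tP B C y).
- apply/crossfreeP => _ _ i j k l /imsetP[B + ->] /imsetP[C + ->].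
  rewrite !inE => /andP[BP _] /andP[CP _] /andP[_ iB] /andP[_ jC] /andP[_ kB] /andP[_ lC].
  by move=> ij jk kl; rewrite (xP B C i j k l).
Qed.

Lemma nc_join_nc Q1 Q2 : nc_partition Dlt Q1 -> nc_partition Dge Q2 ->
  [/\ nc_partition D (nc_join (Q1, Q2)), next_in_block (nc_join (Q1, Q2)),
      nc_split (nc_join (Q1, Q2)) = (Q1, Q2)
    & #|nc_join (Q1, Q2)| = (#|Q1| + #|Q2|)%N].
Proof.
case/andP => /partition_spec[Q10 Q1D cQ1 tQ1] /crossfreeP xQ1.
case/andP => /partition_spec[Q20 Q2D cQ2 tQ2] /crossfreeP xQ2.
have [xa xD'] := setD1P xD.
have inlt B y : B \in Q1 -> y \in B -> [/\ y != a, y \in D & (y < x)%N].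
  by move=> BQ /(Q1D _ _ BQ); rewrite !inE => /andP[/andP[-> ->] ->].
have inge B y : B \in Q2 -> y \in B -> [/\ y != a, y \in D & (x <= y)%N].
  by move=> BQ /(Q2D _ _ BQ); rewrite !inE => /andP[/andP[-> ->] ->].
have a1 B : B \in Q1 -> a \notin B.
  by move=> BQ; apply/negP => /(inlt _ _ BQ)[]; rewrite eqxx.
have a2 B : B \in Q2 -> a \notin B.
  by move=> BQ; apply/negP => /(inge _ _ BQ)[]; rewrite eqxx.
have ltax := a_lt _ xD.
have inadd B y : B \in Q2 -> (y \in add_min B) = (y \in B) || ((y == a) && (x \in B)).
  by move=> BQ; rewrite /add_min; case: ifP => xB; rewrite ?inE ?andbF ?orbF ?andbT // orbC.
have addD1 B : B \in Q2 -> add_min B :\ a = B.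
  move=> BQ; apply/setP => y; rewrite inE inadd //= inE.
  by case: (eqVneq y a) => [->|_] /=; rewrite ?(negbTE (a2 _ BQ)) ?orbF.
have nsub B : B \in Q2 -> ~~ (add_min B \subset Dlt).
  move=> BQ; have [y yB] := Q20 _ BQ; apply/subsetPn; exists y.
    by rewrite inadd // yB.
  by rewrite !inE; have [_ _ xy] := inge _ _ BQ yB; rewrite ltnNge xy andbF.
have sub1 B : B \in Q1 -> B \subset Dlt.
  by move=> BQ; apply/subsetP => y /(Q1D _ _ BQ).
have dis : [disjoint Q1 & add_min @: Q2].
  apply/pred0Pn => -[B /andP[/= BQ /imsetP[C CQ BC]]].
  by move: (sub1 _ BQ); rewrite BC; apply/negP; exact: nsub.
have inj : {in Q2 &, injective add_min}.
  by move=> B C BQ CQ e; rewrite -(addD1 B) // e addD1.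
have [X XQ xX] : exists2 B, B \in Q2 & x \in B.
  by apply: cQ2; rewrite !inE xa xD' leqnn.
split.
- apply/andP; split.
    apply/partition_spec; split.
    + move=> B' /setUP[/Q10//|/imsetP[B BQ ->]].
      by have [y yB] := Q20 _ BQ; exists y; rewrite inadd // yB.
    + move=> B' y /setUP[BQ /(inlt _ _ BQ)[]//|/imsetP[B BQ ->]].
      by rewrite inadd // => /orP[/(inge _ _ BQ)[]//|/andP[/eqP ->]].
    + move=> y yD; have [->|ya] := eqVneq y a.
        exists (add_min X); last by rewrite inadd // eqxx xX orbT.
        by apply/setUP; right; apply: imset_f.
      have [yx|xy] := ltnP y x.
        have [|B BQ yB] := cQ1 y; first by rewrite !inE ya yD yx.
        by exists B => //; apply/setUP; left.
      have [|B BQ yB] := cQ2 y; first by rewrite !inE ya yD xy.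
      exists (add_min B); last by rewrite inadd // yB.
      by apply/setUP; right; apply: imset_f.
    + move=> B' C' y /setUP[BQ|/imsetP[B BQ ->]] /setUP[CQ|/imsetP[C CQ ->]].
      * exact: tQ1.
      * move=> /(inlt _ _ BQ)[ya _ yx]; rewrite inadd // (negbTE ya) orbF.
        by case/(inge _ _ CQ) => _ _; rewrite leqNgt yx.
      * move=> + /(inlt _ _ CQ)[ya _ yx]; rewrite inadd // (negbTE ya) orbF.
        by case/(inge _ _ BQ) => _ _; rewrite leqNgt yx.
      * rewrite !inadd // => /orP[yB|/andP[/eqP -> xB]].
          case/orP => [yC|/andP[/eqP ya xC]]; first by rewrite (tQ2 B C y).
          by move: (a2 _ BQ); rewrite -ya yB.
        case/orP => [aC|/andP[_ xC]]; first by move: (a2 _ CQ); rewrite aC.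
        by rewrite (tQ2 B C x).
  apply/crossfreeP => B' C' i j k l /setUP[BQ|/imsetP[B BQ ->]] /setUP[CQ|/imsetP[C CQ ->]].
  + exact: xQ1.
  + move=> /(inlt _ _ BQ)[ia iD ix] jC /(inlt _ _ BQ)[ka kD kx] lC ij jk kl.
    have ai : (a < i)%N by apply: a_lt; rewrite !inE ia iD.
    move: jC; rewrite inadd // => /orP[/(inge _ _ CQ)[_ _]|/andP[/eqP ja _]].
      by rewrite leqNgt (ltn_trans jk kx).
    by move: (ltn_trans ij jk) (ltn_trans ai ij); rewrite ja ltnn.
  + move=> _ /(inlt _ _ CQ)[ja jD jx] kB /(inlt _ _ CQ)[la lD lx] ij jk kl.
    have aj : (a < j)%N by apply: a_lt; rewrite !inE ja jD.
    move: kB; rewrite inadd // => /orP[/(inge _ _ BQ)[_ _]|/andP[/eqP ka _]].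
      by rewrite leqNgt (ltn_trans kl lx).
    by move: (ltn_trans aj jk); rewrite ka ltnn.
  + rewrite !inadd // => iB jC kB lC ij jk kl.
    have gea E (y : 'I_N) : E \in Q2 -> (y \in E) || (y == a) && (x \in E) -> (a <= y)%N.
      move=> EQ /orP[/(inge _ _ EQ)[_ _]|/andP[/eqP -> _]//].
      exact/leq_trans/ltnW.
    have ge E (y : 'I_N) : E \in Q2 -> (y \in E) || (y == a) && (x \in E) -> (a < y)%N -> y \in E.
      by move=> EQ /orP[//|/andP[/eqP -> _]]; rewrite ltnn.
    have ai := gea _ _ BQ iB.
    have aj := leq_ltn_trans ai ij; have ak := ltn_trans aj jk.
    have {}jC : j \in C by exact: ge jC aj.
    have {}kB : k \in B by exact: ge kB ak.
    have {}lC : l \in C by exact: ge lC (ltn_trans ak kl).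
    (* Only [i] can still be the added [a]. It was added to the block of [x], the least element of
       [Dge], so [x] takes its place: either [x < j] gives a crossing inside [Q2], or [j = x] lies
       in both blocks. *)
    case/orP: iB => [iB|/andP[_ xB]]; first by rewrite (xQ2 B C i j k l).
    have [_ _ xj] := inge _ _ CQ jC.
    case: (ltnP x j) => [xj'|jx]; first by rewrite (xQ2 B C x j k l).
    by rewrite (tQ2 B C x) // (_ : x = j) //; apply/val_inj/eqP; rewrite /= eqn_leq xj.
- exists (add_min X); split.
  + by apply/setUP; right; apply: imset_f.
  + by rewrite inadd // eqxx xX orbT.
  + by rewrite inadd // xX.
  + move=> y; rewrite inadd // => /orP[/(inge _ _ XQ)[]//|/andP[/eqP ->]].
    by rewrite eqxx.
- rewrite /nc_split /nc_join /=; congr (_, _).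
    apply/setP => B; rewrite !inE; apply/andP/idP => [[/orP[//|]]|BQ].
      by case/imsetP => C CQ -> /(negP (nsub _ CQ)).
    by rewrite BQ sub1.
  apply/setP => B; apply/imsetP/idP => [[C + ->]|BQ].
    rewrite !inE => /andP[/orP[/sub1 -> //|/imsetP[E EQ ->] _]].
    by rewrite addD1.
  exists (add_min B); last by rewrite addD1.
  by rewrite !inE nsub // imset_f // orbT.
- by rewrite /nc_join cardsU (disjoint_setI0 dis) cards0 subn0 card_in_imset.
Qed.

End Next.

Lemma next_in_block_exists P : nc_partition D P -> [set a] \notin P ->
  exists2 x, x \in D :\ a & next_in_block x P.
Proof.
case/andP => /partition_spec[P0 PD cP tP] _ aP.
have [B BP aB] := cP a aD.
have [z zB za] : exists2 z, z \in B & z != a.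
  have /subsetPn[z zB] : ~~ (B \subset [set a]).
    apply: contra aP; rewrite subset1 => /orP[/eqP <- //|/eqP B0].
    by rewrite B0 inE in aB.
  by rewrite inE; exists z.
case: (@arg_minnP _ z (fun y => (y \in B) && (y != a)) val); first by rewrite zB.
move=> x /andP[xB xa] xmin; exists x; first by rewrite !inE xa (PD _ _ BP xB).
by exists B; split => // y yB ya; apply: xmin; rewrite yB.
Qed.

Lemma next_in_block_unique P x y : nc_partition D P ->
  x \in D :\ a -> y \in D :\ a -> next_in_block x P -> next_in_block y P -> x = y.
Proof.
case/andP => /partition_spec[_ _ _ tP] _ /setD1P[xa _] /setD1P[ya _].
case=> B [BP aB xB Bmin] [C [CP aC yC Cmin]]; apply: val_inj; apply/eqP.
have BC := tP _ _ _ BP CP aB aC; rewrite -BC in yC Cmin.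
by rewrite eqn_leq Bmin // Cmin.
Qed.

Lemma next_in_block_nonsingleton P x : nc_partition D P -> x \in D :\ a ->
  next_in_block x P -> [set a] \notin P.
Proof.
case/andP => /partition_spec[_ _ _ tP] _ /setD1P[/eqP xa _] [B [BP aB xB _]].
apply/negP => aP; case: xa; apply/set1P.
by rewrite (tP [set a] B a aP BP _ aB) // inE.
Qed.

(* Either {a} is a block, or the block of a has a next element x, which separates the
   partition into one of the elements between a and x and one of the elements from x on. *)
Lemma nc_partition_sum_rec (K : comNzRingType) (l : K) :
  \sum_(P | nc_partition D P) l ^+ #|P| =
    l * \sum_(P | nc_partition (D :\ a) P) l ^+ #|P| +
    \sum_(x in D :\ a)
      (\sum_(P | nc_partition [set y in D :\ a | (y < x)%N] P) l ^+ #|P|) *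
      (\sum_(P | nc_partition [set y in D :\ a | (x <= y)%N] P) l ^+ #|P|).
Proof.
rewrite (bigID (fun P => [set a] \in P)) /=; congr (_ + _).
  rewrite (reindex_onto (fun Q => [set a] |: Q) (fun P => P :\ [set a])) /=; last first.
    by move=> P /andP[_ aP]; rewrite setD1K.
  rewrite mulr_sumr; apply: eq_big => [Q|Q].
    apply/idP/idP => [/andP[/andP[ncQ aQ] /eqP <-]|ncQ].
      exact: nc_partition_del_singleton.
    have [-> aQ] := nc_partition_singleton _ ncQ.
    by rewrite setU11 /= setU1K.
  case/andP => /andP[ncQ aQ] /eqP eQ; rewrite cardsU1 -{1}eQ !inE eqxx /=.
  by rewrite exprS.
(* The default [a] is not returned for the partitions summed here: the singleton of [a] is not one
   of their blocks, so a next element exists. *)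
pose nxt P := odflt a [pick x in D :\ a | `[< next_in_block x P >]].
have nxtP P : nc_partition D P -> [set a] \notin P ->
    nxt P \in D :\ a /\ next_in_block (nxt P) P.
  move=> ncP /(next_in_block_exists _ ncP)[x xD nx]; rewrite /nxt.
  case: pickP => [y /andP[yD /asboolP] //|/(_ x)].
  by rewrite xD; move/asboolP: nx => ->.
rewrite (partition_big nxt (mem (D :\ a))) /=; last by move=> P /andP[? ?]; have [] := nxtP P.
apply: eq_bigr => x xD; rewrite big_distrlr /= pair_big /=.
rewrite (reindex_onto (nc_join x) (nc_split x)) /=; last first.
  move=> P /andP[/andP[ncP aP] /eqP nx]; have [] := nxtP P ncP aP.
  by rewrite nx => _ ?; apply: nc_splitK.
have good (Q : {set {set 'I_N}} * {set {set 'I_N}}) :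
    nc_partition [set y in D :\ a | (y < x)%N] Q.1 &&
    nc_partition [set y in D :\ a | (x <= y)%N] Q.2 ->
    [/\ nc_partition D (nc_join x Q), next_in_block x (nc_join x Q),
      nc_split x (nc_join x Q) = Q & #|nc_join x Q| = (#|Q.1| + #|Q.2|)%N].
  by case: Q => Q1 Q2 /andP[ncQ1 ncQ2]; apply: nc_join_nc.
have cond (Q : {set {set 'I_N}} * {set {set 'I_N}}) :
    (nc_partition D (nc_join x Q) && ([set a] \notin nc_join x Q)
      && (nxt (nc_join x Q) == x) && (nc_split x (nc_join x Q) == Q)) =
    nc_partition [set y in D :\ a | (y < x)%N] Q.1 &&
    nc_partition [set y in D :\ a | (x <= y)%N] Q.2.
  apply/idP/idP => [/andP[/andP[/andP[ncP aP] /eqP nx] /eqP <-]|/good[ncP nP -> _]].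
    have [_ nP] := nxtP _ ncP aP; rewrite nx in nP.
    by have [-> ->] := nc_split_nc _ xD _ ncP nP.
  have aP := next_in_block_nonsingleton _ _ ncP xD nP.
  have [yD yP] := nxtP _ ncP aP.
  by rewrite ncP aP (next_in_block_unique _ _ _ ncP yD xD yP nP) !eqxx.
apply: eq_big => [Q|Q]; first exact: cond.
by rewrite cond => /good[_ _ _ ->]; rewrite exprD.
Qed.

End Decomposition.

(** The rank of [x] in [D] runs bijectively through the ordinals below [#|D|], and both cardinals
    are functions of it. *)
Lemma sum_rank (K : comNzRingType) (D : {set 'I_N}) (F : nat -> nat -> K) :
  \sum_(x in D) F #|[set y in D | (y < x)%N]| #|[set y in D | (x <= y)%N]| =
  \sum_(j < #|D|) F j (#|D| - j)%N.
Proof.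
pose rk (x : 'I_N) := #|[set y in D | (y < x)%N]|.
have rk_lt x : x \in D -> (rk x < #|D|)%N.
  move=> xD; apply: proper_card; apply/properP; split.
    by apply/subsetP => y; rewrite inE => /andP[].
  by exists x => //; rewrite inE ltnn andbF.
have rk_mono x y : x \in D -> (x < y)%N -> (rk x < rk y)%N.
  move=> xD xy; apply: proper_card; apply/properP; split.
    apply/subsetP => z; rewrite !inE => /andP[-> zx] /=; exact: ltn_trans xy.
  by exists x; rewrite !inE xD ?xy // ltnn.
have rk_ge x : #|[set y in D | (x <= y)%N]| = (#|D| - rk x)%N.
  rewrite -(cardsID [set y : 'I_N | (y < x)%N] D).
  rewrite (_ : D :&: _ = [set y in D | (y < x)%N]); last by apply/setP => y; rewrite !inE.
  rewrite addKn; apply: eq_card => y; rewrite !inE -leqNgt andbC //.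
case: (posnP #|D|) => [D0|Dgt].
  rewrite big1 ?D0 ?big_ord0 // => x xD.
  by move: (card0_eq D0 x); rewrite xD.
have [n Dn] : exists n, #|D| = n.+1 by exists #|D|.-1; rewrite prednK.
pose h (x : 'I_N) : 'I_n.+1 := inord (rk x).
have hv x : x \in D -> h x = rk x :> nat by move=> xD; rewrite inordK // -Dn rk_lt.
have hinj : {in D &, injective h}.
  move=> x y xD yD /(congr1 val) /=; rewrite !hv // => e; apply: val_inj.
  case: (ltngtP x y) => // /rk_mono; first by move/(_ xD); rewrite e ltnn.
  by move/(_ yD); rewrite e ltnn.
have hD : h @: D = [set: 'I_n.+1].
  by apply/eqP; rewrite eqEcard subsetT cardsT card_ord card_in_imset // Dn leqnn.
transitivity (\sum_(j in h @: D) F j (n.+1 - j)%N).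
  rewrite big_imset //=; apply: eq_bigr => x xD; rewrite hv // rk_ge Dn //.
by rewrite hD Dn; apply: eq_bigl => j; rewrite inE.
Qed.

Lemma nc_partition_sum (K : comNzRingType) (l : K) (m : nat -> K) :
  m 0 = 1 ->
  (forall n, m n.+1 = l * m n + \sum_(i < n) m i.+1 * m (n.-1 - i)%N) ->
  forall D, \sum_(P | nc_partition D P) l ^+ #|P| = m #|D|.
Proof.
move=> m0 mS D; move: {2}#|D|.+1 (ltnSn #|D|) => n.
elim: n D => // n IH D; rewrite ltnS => Dn.
have [->|/set0Pn[a0 a0D]] := eqVneq D finset.set0.
  rewrite cards0 m0 (eq_bigl (pred1 finset.set0)) ?big_pred1_eq ?cards0 // => P.
  apply/idP/eqP => [/andP[/partition_spec[P0 PD _ _] _]|->].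
    apply/setP => B; rewrite inE; apply/negP => BP.
    by have [y /(PD _ _ BP)] := P0 _ BP; rewrite inE.
  apply/andP; split.
    by apply/partition_spec; split => [B|B y|y|B C y]; rewrite inE.
  by apply/crossfreeP => B C i j k l0; rewrite inE.
case: (@arg_minnP _ a0 (mem D) val a0D) => a aD amin.
have Da : #|D| = #|D :\ a|.+1 by rewrite (cardsD1 a) (aD : a \in D).
rewrite (nc_partition_sum_rec _ a) // Da mS; congr (_ * _ + _).
  by rewrite IH // -ltnS -Da.
have le (E : {set 'I_N}) : E \subset D :\ a -> (#|E| < n)%N.
  by move=> ED; apply: leq_ltn_trans (subset_leq_card ED) _; rewrite -Da.
transitivity (\sum_(x in D :\ a) m #|[set y in D :\ a | (y < x)%N]| *
                                  m #|[set y in D :\ a | (x <= y)%N]|).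
  by apply: eq_bigr => x xD; rewrite !IH //; apply: le; apply/subsetP => y; rewrite inE => /andP[].
(* The part from [x] on is nonempty; reversing the ordinals makes its size the index [i.+1] of the
   recurrence. *)
rewrite (sum_rank _ _ (fun i j => m i * m j)) (reindex_inj rev_ord_inj) /=.
by apply: eq_bigr => i _; rewrite mulrC subKn // -subn1 -subnDA add1n.
Qed.

End NoncrossingPartitions.

From mathcomp Require Import sesquilinear complex.
From mathcomp Require Import all_classical all_reals all_analysis.
From mathcomp Require Import measurable_realfun.

Import numFieldNormedType.Exports.

Local Open Scope classical_set_scope.
Local Open Scope complex_scope.
Local Open Scope ring_scope.

(** * Free cumulants and the regression identities *)

(** Course-of-values recursion with the earlier values kept in a list; the hypothesis makes the
    default [t0] beyond its end harmless. *)
Lemma strong_recursion (T : Type) (t0 : T) (step : nat -> (nat -> T) -> T) :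
  (forall n f g, (forall k, (k < n)%N -> f k = g k) -> step n f = step n g) ->
  exists f, forall n, f n = step n f.
Proof.
move=> stepP.
pose fix s n := if n is m.+1 then rcons (s m) (step m (nth t0 (s m))) else [::].
have sz n : size (s n) = n by elim: n => //= n IH; rewrite size_rcons IH.
have nthS k n : (k < n)%N -> nth t0 (s n) k = nth t0 (s k.+1) k.
  elim: n => // n IH; rewrite ltnS leq_eqVlt => /orP[/eqP -> //|kn].
  by rewrite [in LHS]/= nth_rcons sz kn IH.
exists (fun n => nth t0 (s n.+1) n) => n.
rewrite [in LHS]/= nth_rcons sz ltnn eqxx; apply: stepP => k kn.
exact: nthS.
Qed.

(** Associativity of convolution: both sides run over the triples of naturals with sum [n]. *)
Lemma triangular_sum (V : nmodType) (F : nat -> nat -> nat -> V) n :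
  \sum_(i < n.+1) \sum_(k < i.+1) F k (i - k)%N (n - i)%N =
  \sum_(k < n.+1) \sum_(j < (n - k).+1) F k j (n - k - j)%N.
Proof.
transitivity (\sum_(i < n.+1) \sum_(k < n.+1 | (k <= i)%N) F k (i - k)%N (n - i)%N).
  apply: eq_bigr => i _.
  by rewrite (big_ord_widen n.+1 (fun k => F k (i - k)%N (n - i)%N)) // ltn_ord.
rewrite (exchange_big_dep xpredT) //=; apply: eq_bigr => k _.
have kn : (k <= n)%N by rewrite -ltnS.
rewrite -subSn // -(big_mkord xpredT (fun j => F k j (n - k - j)%N)).
transitivity (\sum_(k <= i < n.+1) F k (i - k)%N (n - i)%N).
  rewrite -(big_mkord (fun i => (k <= i)%N) (fun i => F k (i - k)%N (n - i)%N)).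
  rewrite (@big_cat_nat _ _ _ k) //=; last exact: leqW.
  rewrite big_nat_cond big_pred0 ?add0r => [|i]; last first.
    by case: ltnP => //= ik; case: leqP.
  rewrite big_nat_cond [RHS]big_nat_cond; apply: eq_bigl => i.
  by case: (leqP k i).
rewrite -{1}(add0n (k : nat)) big_addn; apply: eq_bigr => i _.
by rewrite addnK [(i + k)%N]addnC subnDA.
Qed.

Section GeneratedAlgebra.
Context {R : realType} {A : algType R[i]}.
Implicit Types (x p q : A).

Lemma generated_algebra1 x : generated_algebra x 1.
Proof. by exists 1 => //; rewrite rmorph1. Qed.

Lemma generated_algebra0 x : generated_algebra x 0.
Proof. by exists 0 => //; rewrite rmorph0. Qed.

Lemma generated_algebra_id x : generated_algebra x x.
Proof. by exists 'X => //; rewrite horner_algX. Qed.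

Lemma generated_algebraD x p q : generated_algebra x p -> generated_algebra x q ->
  generated_algebra x (p + q).
Proof. by move=> [P _ <-] [Q _ <-]; exists (P + Q) => //; rewrite rmorphD. Qed.

Lemma generated_algebraZ x k p : generated_algebra x p ->
  generated_algebra x (k *: p).
Proof. by move=> [P _ <-]; exists (k *: P) => //; rewrite linearZ /= mulr_algl. Qed.

Lemma generated_algebraB x p q : generated_algebra x p -> generated_algebra x q ->
  generated_algebra x (p - q).
Proof. by move=> [P _ <-] [Q _ <-]; exists (P - Q) => //; rewrite rmorphB. Qed.

Lemma generated_algebraM x p q : generated_algebra x p -> generated_algebra x q ->
  generated_algebra x (p * q).
Proof. by move=> [P _ <-] [Q _ <-]; exists (P * Q) => //; rewrite rmorphM. Qed.

Lemma generated_algebra_sum x I (s : seq I) (F : I -> A) :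
  (forall i, generated_algebra x (F i)) ->
  generated_algebra x (\sum_(i <- s) F i).
Proof.
move=> xF; elim/big_rec: _ => [|i p _ xp]; first exact: generated_algebra0.
exact: generated_algebraD.
Qed.

(** Serves to move polynomials in [S] past [S^(1/2)]. *)
Lemma generated_algebra_comm x p q : generated_algebra x p ->
  x * q = q * x -> p * q = q * p.
Proof.
move=> [P _ <-] xq; elim/poly_ind: P => [|P c IH].
  by rewrite rmorph0 mul0r mulr0.
rewrite rmorphD rmorphM /= horner_algX horner_algC mulrDl mulrDr -mulrA xq mulrA IH.
by rewrite -!mulrA -scalerAl -scalerAr mul1r mulr1.
Qed.

End GeneratedAlgebra.

Section FreeVariables.
Context {R : realType} {A : algType R[i]}.
Variable tau : {scalar A}.
Hypothesis tau1 : tau 1 = 1.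

Lemma tau_unit (b : bool) : tau b%:R = b%:R.
Proof. by case: b; rewrite ?linear0. Qed.

Definition centered (a : A) := a - tau a *: 1.

Lemma tau_centered a : tau (centered a) = 0.
Proof. by rewrite linearB linearZ /= tau1 mulr1 subrr. Qed.

Lemma centeredE a : a = centered a + tau a *: 1.
Proof. by rewrite subrK. Qed.

Lemma generated_algebra_centered x a : generated_algebra x a ->
  generated_algebra x (centered a).
Proof.
by move=> xa; apply/generated_algebraB/generated_algebraZ/generated_algebra1.
Qed.

(* The polynomials a_n(X) are the free Appell polynomials of X, and r_n is the free
   cumulant of X of order n + 1. *)
Lemma free_appell (X : A) : exists (a : nat -> A) (r : nat -> R[i]),
  [/\ a 0 = 1, forall n, a n.+1 = X * a n - \sum_(k < n.+1) r k *: a (n - k)%N,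
      forall n, tau (a n) = (n == 0%N)%:R, forall n, tau (X * a n) = r n
    & forall n, generated_algebra X (a n)].
Proof.
(* The coefficient [tau (X * a k)] is read off a term already built. At [k = m] it multiplies
   [a 0 = 1] and centers the new term; the other [a (m - k)] are centered already. *)
pose step n (a : nat -> A) := if n is m.+1 then
  X * a m - \sum_(k < m.+1) tau (X * a k) *: a (m - k)%N else 1.
have [[//|n] f g fg|a aE] := strong_recursion _ 0 step.
  rewrite /= fg //; congr (_ - _); apply: eq_bigr => k _.
  by rewrite !fg // ltnS leq_subr.
exists a, (fun n => tau (X * a n)).
have a0 : a 0 = 1 by rewrite aE.
have aS n : a n.+1 = X * a n - \sum_(k < n.+1) tau (X * a k) *: a (n - k)%N.
  by rewrite aE.
split=> // [n|n].
- elim/ltn_ind: n => -[|n] IH; first by rewrite a0.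
  rewrite aS linearB linear_sum big_ord_recr /= subnn big1 => [|k _]; last first.
    by rewrite linearZ /= IH ?ltnS ?leq_subr // subn_eq0 leqNgt ltn_ord mulr0.
  by rewrite linearZ /= a0 tau1 add0r mulr1 subrr.
- elim/ltn_ind: n => -[|n] IH; first by rewrite a0; exact: generated_algebra1.
  rewrite aS; apply: generated_algebraB.
    by apply: generated_algebraM; [exact: generated_algebra_id|exact: IH].
  apply: generated_algebra_sum => k; apply: generated_algebraZ.
  by apply: IH; rewrite ltnS leq_subr.
Qed.

Section Alternating.
Variable B : bool -> set A.
Hypothesis freeB : free_subsets tau B.

(* A product of centered letters, alternating between the two algebras, that remains
   alternating when a letter of B b is appended. *)
Definition alternating b (v : A) := exists n (i : nat -> bool) (a : nat -> A),
  [/\ v = \prod_(j < n) a j,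
      forall j, (j < n)%N -> B (i j) (a j) /\ tau (a j) = 0,
      forall j, (j.+1 < n)%N -> i j <> i j.+1
    & (0 < n)%N -> i n.-1 <> b].

(** Meant for sums [w] of alternating products that begin in [B b]. Testing against every [v], and
    not just asking [tau w = 0], makes the property survive a further letter on the left. *)
Definition vanishing b (w : A) := forall v, alternating b v -> tau (v * w) = 0.

Lemma alternating1 b : alternating b 1.
Proof. by exists 0, (fun=> b), (fun=> 1); rewrite big_ord0. Qed.

Lemma alternating_rcons b v a : alternating b v -> B b a -> tau a = 0 ->
  alternating (~~ b) (v * a) /\ tau (v * a) = 0.
Proof.
case=> n [i [c [-> cB ialt ib]]] Ba ta.
pose i' j := if (j < n)%N then i j else b.
pose c' j := if (j < n)%N then c j else a.
have vE : \prod_(j < n) c j * a = \prod_(j < n.+1) c' j.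
  rewrite big_ord_recr /= /c' ltnn; congr (_ * _).
  by apply: eq_bigr => j _; rewrite ltn_ord.
have cB' j : (j < n.+1)%N -> B (i' j) (c' j) /\ tau (c' j) = 0.
  by move=> _; rewrite /i' /c'; case: ifP => [/cB //|].
have ialt' j : (j.+1 < n.+1)%N -> i' j <> i' j.+1.
  rewrite ltnS /i' => jn; rewrite jn; case: ltnP => jn'; first exact: ialt.
  have jE : n = j.+1 by apply/eqP; rewrite eqn_leq jn jn'.
  by move: ib; rewrite jE; apply.
split; last by rewrite vE; apply: (freeB n.+1 i').
exists n.+1, i', c'; split=> // _.
by rewrite /= /i' ltnn; case: b {ib i' c' vE cB' ialt' Ba}.
Qed.

Lemma vanishing_letter b a : B b a -> tau a = 0 -> vanishing b a.
Proof. by move=> Ba ta v /alternating_rcons/(_ Ba ta)[]. Qed.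

Lemma vanishing_cons b a w : B b a -> tau a = 0 -> vanishing (~~ b) w ->
  vanishing b (a * w).
Proof.
by move=> Ba ta vw v /alternating_rcons/(_ Ba ta)[va _]; rewrite mulrA vw.
Qed.

Lemma vanishing0 b : vanishing b 0.
Proof. by move=> v _; rewrite mulr0 linear0. Qed.

Lemma vanishingD b w w' : vanishing b w -> vanishing b w' -> vanishing b (w + w').
Proof. by move=> vw vw' v av; rewrite mulrDr linearD /= vw ?vw' ?addr0. Qed.

Lemma vanishing_sum b I (s : seq I) (F : I -> A) :
  (forall i, vanishing b (F i)) -> vanishing b (\sum_(i <- s) F i).
Proof.
move=> vF; elim/big_rec: _ => [|i p _ vp]; first exact: vanishing0.
exact: vanishingD.
Qed.

Lemma vanishing_tau b w : vanishing b w -> tau w = 0.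
Proof. by move/(_ 1 (alternating1 b)); rewrite mul1r. Qed.

(** The centered part of [a] is an alternating product that [w] continues; the scalar part meets
    [tau w = 0]. *)
Lemma vanishing_letter_mul b a w : B (~~ b) (centered a) -> vanishing b w ->
  tau (a * w) = 0.
Proof.
move=> Ba vw; rewrite {1}[a]centeredE mulrDl linearD /= -scalerAl mul1r linearZ /=.
rewrite (vanishing_tau _ _ vw) mulr0 addr0.
have [] := alternating_rcons (~~ b) 1 _ (alternating1 _) Ba (tau_centered a).
by rewrite negbK mul1r => + _; apply: vw.
Qed.

End Alternating.

Lemma free_rv_tauM X Y p q : free_rv tau X Y -> generated_algebra X p ->
  generated_algebra Y q -> tau (p * q) = tau p * tau q.
Proof.
move=> fXY Xp Yq.
rewrite {1}[q]centeredE mulrDr linearD /= -scalerAr mulr1 linearZ /= mulrC.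
rewrite (vanishing_letter_mul _ fXY false) ?add0r //; first exact: generated_algebra_centered.
apply: vanishing_letter => //; first exact: generated_algebra_centered.
exact: tau_centered.
Qed.

(* The generating series of q_n is the resolvent of X + Y in Haagerup's proof of the
   additivity of the R-transform: with E_X = sum_(n > 0) a_n u^n and E_Y likewise, it is
   the sum of all alternating products of E_X and E_Y, and x_n, y_n collect those
   starting with E_X, E_Y. *)
Lemma free_sum_appell (X Y : A) (a b : nat -> A) (r r' : nat -> R[i]) :
  free_rv tau X Y ->
  a 0 = 1 -> (forall n, a n.+1 = X * a n - \sum_(k < n.+1) r k *: a (n - k)%N) ->
  (forall n, tau (a n) = (n == 0%N)%:R) -> (forall n, tau (X * a n) = r n) ->
  (forall n, generated_algebra X (a n)) ->
  b 0 = 1 -> (forall n, b n.+1 = Y * b n - \sum_(k < n.+1) r' k *: b (n - k)%N) ->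
  (forall n, tau (b n) = (n == 0%N)%:R) -> (forall n, generated_algebra Y (b n)) ->
  exists q : nat -> A,
  [/\ forall n, generated_algebra (X + Y) (q n),
      forall n, tau (X * q n) = r n,
      forall n, tau ((X + Y) * q n) = r n + r' n,
      forall n, tau (X ^+ 2 * q n) = r n.+1 + \sum_(k < n.+1) r k * r (n - k)%N
    & forall n, tau ((X + Y) ^+ 2 * q n) = r n.+1 + r' n.+1
        + \sum_(k < n.+1) (r k + r' k) * (r (n - k)%N + r' (n - k)%N)].
Proof.
move=> fXY a0 aS ta tXa aX b0 bS tb bY.
pose B c := generated_algebra (if c then X else Y).
pose e (n : nat) : A := (n == 0%N)%:R.
(* As formal series, [x = E_X (1 + y)] and [y = E_Y (1 + x)]; [e] is the coefficient sequence of
   1. *)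
pose step n (z : nat -> A * A) :=
  (\sum_(i < n) a i.+1 * (e (n - i.+1)%N + (z (n - i.+1)%N).2),
   \sum_(i < n) b i.+1 * (e (n - i.+1)%N + (z (n - i.+1)%N).1)).
have lt n (i : 'I_n) : (n - i.+1 < n)%N.
  by rewrite ltn_subrL /= (leq_ltn_trans _ (ltn_ord i)).
have [n f g fg|z zE] := strong_recursion _ (0, 0) step.
  congr (_, _); apply: eq_bigr => i _; by rewrite fg.
pose x n := (z n).1; pose y n := (z n).2.
have xE n : x n = \sum_(i < n) a i.+1 * (e (n - i.+1)%N + y (n - i.+1)%N).
  by rewrite /x zE.
have yE n : y n = \sum_(i < n) b i.+1 * (e (n - i.+1)%N + x (n - i.+1)%N).
  by rewrite /y zE.
have vxy n : vanishing B true (x n) /\ vanishing B false (y n).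
  elim/ltn_ind: n => n IH.
  rewrite xE yE; split; apply: vanishing_sum => i; rewrite mulrDr.
    have ta0 : tau (a i.+1) = 0 by rewrite ta.
    apply: vanishingD; last first.
      by apply: vanishing_cons => //; [exact: aX|exact: (IH _ (lt _ i)).2].
    rewrite /e; case: eqP => _; rewrite ?mulr0; last exact: vanishing0.
    by rewrite mulr1; apply: vanishing_letter => //; exact: aX.
  have tb0 : tau (b i.+1) = 0 by rewrite tb.
  apply: vanishingD; last first.
    by apply: vanishing_cons => //; [exact: bY|exact: (IH _ (lt _ i)).1].
  rewrite /e; case: eqP => _; rewrite ?mulr0; last exact: vanishing0.
  by rewrite mulr1; apply: vanishing_letter => //; exact: bY.
pose q n := e n + x n + y n.
(* With [C] the series of [c] in an indeterminate [t], the recurrence reads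
   [V C = (C - 1) / t + s C]. Since [q = C (1 + v)] and [(C - 1) (1 + v)] is the series of [u], the
   product [V q] is [u] shifted by one plus [s q]. *)
have conv (V : A) (c : nat -> A) (s : nat -> R[i]) (u v : nat -> A) : c 0 = 1 ->
    (forall n, c n.+1 = V * c n - \sum_(k < n.+1) s k *: c (n - k)%N) ->
    (forall n, u n = \sum_(i < n) c i.+1 * (e (n - i.+1)%N + v (n - i.+1)%N)) ->
    (forall n, q n = e n + v n + u n) ->
    forall n, V * q n = u n.+1 + \sum_(k < n.+1) s k *: q (n - k)%N.
  move=> c0 cS uE qE n.
  have qsum m : q m = \sum_(i < m.+1) c i * (e (m - i)%N + v (m - i)%N).
    by rewrite big_ord_recl c0 mul1r subn0 -uE qE.
  rewrite qsum mulr_sumr uE.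
  have -> : \sum_(k < n.+1) s k *: q (n - k)%N =
      \sum_(i < n.+1) \sum_(k < i.+1) s k *: (c (i - k)%N * (e (n - i)%N + v (n - i)%N)).
    rewrite (triangular_sum _ (fun k j l => s k *: (c j * (e l + v l)))).
    by apply: eq_bigr => k _; rewrite qsum scaler_sumr.
  rewrite -big_split; apply: eq_bigr => i _ /=.
  rewrite subSS mulrA -[V * c i](subrK (\sum_(k < i.+1) s k *: c (i - k)%N)) -cS.
  rewrite mulrDl mulr_suml; congr (_ + _).
  by apply: eq_bigr => k _; rewrite scalerAl.
have Xq n : X * q n = x n.+1 + \sum_(k < n.+1) r k *: q (n - k)%N.
  by apply: (conv _ a _ _ y) => // m; rewrite /q addrAC.
have Yq n : Y * q n = y n.+1 + \sum_(k < n.+1) r' k *: q (n - k)%N.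
  by apply: (conv _ b _ _ x).
have tx n : tau (x n) = 0 by apply: vanishing_tau (vxy n).1.
have ty n : tau (y n) = 0 by apply: vanishing_tau (vxy n).2.
have tq n : tau (q n) = (n == 0%N)%:R.
  by rewrite !linearD /= tx ty !addr0 tau_unit.
have sumq (s : nat -> R[i]) n : tau (\sum_(k < n.+1) s k *: q (n - k)%N) = s n.
  rewrite linear_sum big_ord_recr /= subnn linearZ /= tq mulr1 big1 ?add0r // => k _.
  by rewrite linearZ /= tq subn_eq0 leqNgt ltn_ord mulr0.
have tXq n : tau (X * q n) = r n by rewrite Xq linearD /= tx sumq add0r.
have tYq n : tau (Y * q n) = r' n by rewrite Yq linearD /= ty sumq add0r.
have Sq n : (X + Y) * q n = q n.+1 + \sum_(k < n.+1) (r k + r' k) *: q (n - k)%N.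
  have -> : q n.+1 = x n.+1 + y n.+1 by rewrite /q (_ : e n.+1 = 0) ?add0r.
  rewrite mulrDl Xq Yq addrACA -big_split /=; congr (_ + _).
  by under [in RHS]eq_bigr => k _ do rewrite scalerDl.
have tSq n : tau ((X + Y) * q n) = r n + r' n by rewrite mulrDl linearD /= tXq tYq.
exists q; split=> // n.
- elim/ltn_ind: n => -[|n] IH.
    by rewrite /q /e xE yE !big_ord0 !addr0; exact: generated_algebra1.
  have -> : q n.+1 = (X + Y) * q n - \sum_(k < n.+1) (r k + r' k) *: q (n - k)%N.
    by rewrite Sq addrK.
  apply: generated_algebraB.
    by apply: generated_algebraM; [exact: generated_algebra_id|exact: IH].
  apply: generated_algebra_sum => k; apply: generated_algebraZ.
  by apply: IH; rewrite ltnS leq_subr.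
- rewrite expr2 -mulrA Xq mulrDr linearD /= mulr_sumr linear_sum; congr (_ + _).
    (* The products in [y] begin with a letter from [Y], so [X * a i.+1 * y _] has trace 0. Only
       [i = n] is left, where [e 0 = 1] and [y 0 = 0]. *)
    rewrite xE mulr_sumr linear_sum big_ord_recr /= big1 => [|i _]; last first.
      rewrite (_ : e _ = 0) ?add0r ?mulrA; last first.
        by rewrite /e subSS subn_eq0 leqNgt ltn_ord.
      apply: (vanishing_letter_mul _ fXY false); last exact: (vxy _).2.
      apply: generated_algebra_centered; apply: generated_algebraM => //.
      exact: generated_algebra_id.
    by rewrite subnn /e yE big_ord0 addr0 mulr1 add0r tXa.
  by apply: eq_bigr => k _; rewrite -scalerAr linearZ /= tXq.
- rewrite expr2 -mulrA Sq mulrDr linearD /= tSq mulr_sumr linear_sum; congr (_ + _).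
  by apply: eq_bigr => k _; rewrite -scalerAr linearZ /= tSq.
Qed.

End FreeVariables.

(** * Regression of [X] and [X^2] on [S] *)

Section LukacsRegression.
Context {R : realType} {A : algType R[i]}.
Variable tau : {scalar A}.
Hypotheses (tau1 : tau 1 = 1) (tauC : forall a b, tau (a * b) = tau (b * a)).

(** For free pairs [tau (Z S Z q) = tau (Z^2) tau S tau q + (tau Z)^2 tau (S q) - (tau Z)^2 tau S
    tau q]; here the first and last terms are grouped into the variance of [Z]. *)
Lemma free_rv_tau_sandwich (Z S q : A) : free_rv tau Z S ->
  generated_algebra S q ->
  tau (Z * S * Z * q) = tau S * tau (centered tau Z ^+ 2) * tau q
                        + tau Z ^+ 2 * tau (S * q).
Proof.
move=> fZS Sq; pose z := centered tau Z.
have Zz : generated_algebra Z z.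
  by apply: generated_algebra_centered; exact: generated_algebra_id.
have tz : tau z = 0 by exact: tau_centered.
have SS := generated_algebra_id S.
have zq0 p : generated_algebra S p -> tau (z * p) = 0.
  by move=> Sp; rewrite (free_rv_tauM _ tau1 _ _ _ _ fZS) // tz mul0r.
have ZE : Z = z + tau Z *: 1 by exact: centeredE.
have mulrC1 (x y v : A) k : x * (y + k *: 1) * v = x * y * v + k *: (x * v).
  by rewrite mulrDr mulrDl -scalerAr mulr1 -scalerAl.
(* After splitting [S] and [q] into centered and scalar parts, the products that begin with [z * s]
   alternate and drop out. *)
have zSz : tau (z * S * z * q) = tau S * tau (z ^+ 2) * tau q.
  pose s := centered tau S.
  have Ss : generated_algebra S s by exact: generated_algebra_centered.
  have ts : tau s = 0 by exact: tau_centered.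
  have van p : vanishing tau (fun b : bool => generated_algebra (if b then Z else S))
      true p -> tau (z * (s * p)) = 0.
    move=> vp; apply: (vanishing_tau _ _ true); apply: (vanishing_cons _ _ fZS true) => //.
    by apply: (vanishing_cons _ _ fZS false).
  have -> : z * S * z * q = z * (s * (z * centered tau q))
     + tau q *: (z * (s * z)) + tau S *: (z * z * q).
    rewrite -[LHS]mulrA {1}[S](centeredE tau) mulrC1 !mulrA; congr (_ + _).
    by rewrite -[LHS]mulr1 {1}[q](centeredE tau) mulrC1 !mulr1.
  rewrite !linearD !linearZ /= !van ?mulr0 ?add0r; last first.
  - apply: (vanishing_cons _ _ fZS true) => //; apply: (vanishing_letter _ _ fZS false).
      exact: generated_algebra_centered.
    exact: tau_centered.
  - exact: (vanishing_letter _ _ fZS true).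
  rewrite (free_rv_tauM _ tau1 _ _ _ _ fZS) ?expr2 ?mulrA //.
  exact: generated_algebraM.
have ZSq v : generated_algebra S v -> tau (Z * (S * v)) = tau Z * tau (S * v).
  move=> Sv; rewrite (free_rv_tauM _ tau1 _ _ _ _ fZS) //.
    exact: generated_algebra_id.
  exact: generated_algebraM.
rewrite {2}ZE mulrC1 linearD linearZ /= -[Z * S * q]mulrA ZSq //.
rewrite -[X in tau X](mul1r (Z * S * z * q)) -!mulrA mulrA {1}ZE mulrC1 mul1r.
rewrite linearD linearZ /= mul1r !mulrA zSz -!mulrA.
have -> : tau (S * (z * q)) = 0.
  by rewrite tauC -mulrA zq0 //; exact: generated_algebraM.
by rewrite mulr0 addr0; ring.
Qed.

(** The constants are [beta = tau Z] and [gamma = tau S * tau (centered tau Z ^+ 2)]. In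
    [tau (U * Z * U * p)] the trace carries the first [U] round to the end, where it passes [p] and
    completes [S]. *)
Lemma lukacs_regression (X S T : A) : T ^+ 2 * S = 1 -> S * T ^+ 2 = 1 ->
  free_rv tau (T * X * T) S -> exists beta gamma,
  (forall p, generated_algebra S p -> tau (X * p) = beta * tau (S * p)) /\
  (forall p, generated_algebra S p ->
     tau (X ^+ 2 * p) = beta ^+ 2 * tau (S ^+ 2 * p) + gamma * tau (S * p)).
Proof.
move=> T2S ST2 fZS; set Z := T * X * T in fZS.
have STS : S * T = T * S.
  have -> : S * T = S * (T * (T ^+ 2 * S)) by rewrite T2S mulr1.
  by rewrite [T * _]mulrA -exprS exprSr mulrA mulrA ST2 mul1r.
(* U is S^(1/2), the inverse of T. *)
have [U [TU UT UU]] : exists U, [/\ T * U = 1, U * T = 1 & U * U = S].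
  exists (T * S); split; first by rewrite mulrA -expr2.
    by rewrite -mulrA STS mulrA -expr2.
  by rewrite -{1}STS mulrA -[S * T * T]mulrA -expr2 ST2 mul1r.
have US : S * U = U * S by rewrite -UU mulrA.
have XE : X = U * Z * U.
  by rewrite /Z !mulrA UT mul1r -mulrA TU mulr1.
clearbody Z.
have SS := generated_algebra_id S; have ZZ := generated_algebra_id Z.
have pU p : generated_algebra S p -> p * U = U * p.
  by move=> Sp; exact: generated_algebra_comm US.
exists (tau Z), (tau S * tau (centered tau Z ^+ 2)); split => p Sp.
  rewrite XE -!mulrA tauC -!mulrA pU // [U * (U * _)]mulrA UU.
  apply: (free_rv_tauM tau tau1 Z S) => //.
  exact: generated_algebraM.
have -> : tau (X ^+ 2 * p) = tau (Z * S * Z * (S * p)).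
  rewrite expr2 XE -!mulrA tauC -!mulrA pU // [U * (U * p)]mulrA UU.
  by rewrite [U * (U * _)]mulrA UU.
rewrite free_rv_tau_sandwich //; last exact: generated_algebraM.
by rewrite addrC expr2 [S * (S * p)]mulrA -expr2 [in RHS]expr2.
Qed.

End LukacsRegression.

Section SelfAdjoint.
Context {R : realType} {H : completeNormedModType R[i]} {A : algType R[i]}.
Variables (dot : {dot H for (@Num.conj R[i])}) (star : A -> A) (rep : A -> H -> H).
Hypothesis hA : von_neumann_algebra dot star rep.

(** Read off from the Hilbert space: applied to a vector, the operator and its adjoint differ by
    [d], and moving the adjoint across [dot] yields [dot d d = 0]. *)
Lemma self_adjoint_shift (x : A) (k : R) : self_adjoint star x ->
  self_adjoint star (x + k%:C *: 1).
Proof.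
move=> sx; apply: (vna_inj hA); apply/funext => v.
have repE w : rep (x + k%:C *: 1) w = rep x w + k%:C *: w.
  by rewrite addrC (vna_linear hA) (vna_one hA) addrC.
have kreal : Num.conj (k%:C : R[i]) = k%:C.
  by apply/CrealP; apply/complex_realP; exists k.
apply/eqP; rewrite -subr_eq0 -normr_eq0 -sqrf_eq0; apply/eqP.
set d := _ - _; rewrite (vna_hilbert hA) {2}/d.
rewrite linearBr /= -(vna_star hA) !repE linearDl linearDr /=.
rewrite linearZl_LR linearZr_LR /= kreal.
by rewrite (vna_star hA) sx subrr.
Qed.

Variable tau : {scalar A}.
Hypothesis htau : normal_faithful_tracial_state dot star rep tau.

(** By positivity [x ^+ 2] and [(x + 1) ^+ 2] have real trace, and their difference is [2 x + 1]. *)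
Lemma tau_self_adjoint (x : A) : self_adjoint star x ->
  tau x = (mean tau x)%:C.
Proof.
move=> sx; have sq y : self_adjoint star y -> complex.Im (tau (y ^+ 2)) = 0.
  by move=> sy; apply: ger0_Im; rewrite expr2 -{1}sy; exact: (state_ge0 htau).
have := sq _ (self_adjoint_shift x 1 sx).
rewrite rmorph1 scale1r sqrrD1 !linearD (state_one htau) /=.
rewrite /mean; have := sq _ sx; case: (tau (x ^+ 2)) => u v /= ->.
case: (tau x) => a b /= /eqP; rewrite add0r addr0 -mulr2n mulrn_eq0 /= => /eqP ->.
by [].
Qed.

End SelfAdjoint.

Section LukacsMoments.
Context {R : realType} {H : completeNormedModType R[i]} {A : algType R[i]}.
Variables (dot : {dot H for (@Num.conj R[i])}) (star : A -> A) (rep : A -> H -> H).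
Variable tau : {scalar A}.
Hypothesis hA : von_neumann_algebra dot star rep.
Hypothesis htau : normal_faithful_tracial_state dot star rep tau.

Let tau1 : tau 1 = 1 := state_one htau.

Lemma variance_gt0 (x : A) : self_adjoint star x -> nondegenerate_rv x ->
  0 < tau (x ^+ 2) - tau x ^+ 2.
Proof.
move=> sx ndx; have tx := tau_self_adjoint _ _ _ hA _ htau _ sx.
pose h := x + (- mean tau x)%:C *: 1.
have sh : self_adjoint star h by apply: (self_adjoint_shift _ _ _ hA).
have hE : h = x - tau x *: 1 by rewrite /h tx rmorphN scaleNr.
have -> : tau (x ^+ 2) - tau x ^+ 2 = tau (star h * h).
  have tZ k y : tau (k *: y) = k * tau y by rewrite linearZ.
  rewrite sh hE mulrBl !mulrBr -!scalerAr -!scalerAl !mulr1 mul1r.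
  by rewrite 3!linearB 3!tZ tau1 !expr2 mulr1 subrr subr0.
rewrite lt_neqAle (state_ge0 htau) andbT eq_sym; apply/eqP => /(state_faithful htau) h0.
by apply: ndx; exists (tau x); apply/eqP; rewrite -subr_eq0 -hE h0.
Qed.

Lemma appell_moments (x : A) (a : nat -> A) (m c : R[i]) :
  a 0 = 1 ->
  (forall n, a n.+1 = x * a n - \sum_(k < n.+1) (m * c ^+ k) *: a (n - k)%N) ->
  (forall n, tau (a n) = (n == 0%N)%:R) ->
  forall n, tau (x ^+ n.+1) =
    m * tau (x ^+ n) + c * \sum_(i < n) tau (x ^+ i.+1) * tau (x ^+ (n.-1 - i)).
Proof.
move=> a0 aS ta n.
have := geometric_appell_moments _ (fun m n => tau (x ^+ m * a n)) _ m c _ n.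
rewrite a0 !mulr1 => -> //; last first.
- move=> k l; rewrite exprSr -mulrA.
  rewrite -[x * a l](subrK (\sum_(k < l.+1) (m * c ^+ k) *: a (l - k)%N)) -aS.
  rewrite mulrDr linearD mulr_sumr linear_sum /=; congr (_ + _).
  by apply: eq_bigr => j _; rewrite -scalerAr linearZ.
- by move=> k; rewrite mul1r.
by congr (_ + _ * _); apply: eq_bigr => i _; rewrite !mulr1.
Qed.

Lemma lukacs_moments (X Y T : A) :
  self_adjoint star X -> self_adjoint star Y ->
  nondegenerate_rv X -> nondegenerate_rv Y -> free_rv tau X Y ->
  0 < tau (X + Y) -> T ^+ 2 * (X + Y) = 1 -> (X + Y) * T ^+ 2 = 1 ->
  free_rv tau (T * X * T) (X + Y) ->
  exists c m m' : R, [/\ 0 < c, 0 < m, 0 < m',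
    forall n, tau (X ^+ n.+1) = m%:C * tau (X ^+ n)
      + c%:C * \sum_(i < n) tau (X ^+ i.+1) * tau (X ^+ (n.-1 - i))
  & forall n, tau (Y ^+ n.+1) = m'%:C * tau (Y ^+ n)
      + c%:C * \sum_(i < n) tau (Y ^+ i.+1) * tau (Y ^+ (n.-1 - i))].
Proof.
move=> sX sY ndX ndY fXY S0 T2S ST2 fZS.
have [b [g [regX regX2]]] :=
  lukacs_regression _ tau1 (state_tracial htau) _ _ _ T2S ST2 fZS.
have [a [r [a0 aS ta tXa aX]]] := free_appell _ tau1 X.
have [d [r' [d0 dS td tYd dY]]] := free_appell _ tau1 Y.
have [q [qS tXq tSq tXXq tSSq]] :=
  free_sum_appell _ tau1 _ _ _ _ _ _ fXY a0 aS ta tXa aX d0 dS td dY.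
pose rho n := r n + r' n.
have rE n : r n = b * rho n by rewrite -tXq regX // tSq.
have rhoS n : b * (1 - b) * rho n.+1 = g * rho n.
  have := regX2 _ (qS n); rewrite tXXq tSSq tSq -/(rho n) -/(rho n.+1) rE.
  have -> : \sum_(k < n.+1) r k * r (n - k)%N =
            b ^+ 2 * \sum_(k < n.+1) (r k + r' k) * (r (n - k)%N + r' (n - k)%N).
    by rewrite mulr_sumr; apply: eq_bigr => k _; rewrite -/(rho k) -/(rho (n - k)%N) !rE; ring.
  set s := \sum_(k < _) _ => e.
  have -> : b * (1 - b) * rho n.+1 = b * rho n.+1 + b ^+ 2 * s - b ^+ 2 * (rho n.+1 + s).
    by ring.
  by rewrite e; ring.
have rX : r 1 = tau (X ^+ 2) - tau X ^+ 2.
  rewrite -tXa aS a0 mulr1 big_ord1 mulrBr linearB -scalerAr mulr1 linearZ /=.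
  by rewrite -tXa a0 mulr1 -!expr2.
have rY : r' 1 = tau (Y ^+ 2) - tau Y ^+ 2.
  rewrite -tYd dS d0 mulr1 big_ord1 mulrBr linearB -scalerAr mulr1 linearZ /=.
  by rewrite -tYd d0 mulr1 -!expr2.
have rX0 : 0 < r 1 by rewrite rX variance_gt0.
have rY0 : 0 < r' 1 by rewrite rY variance_gt0.
have rho1 : 0 < rho 1 by rewrite addr_gt0.
have bE : b = r 1 / rho 1 by rewrite rE mulfK // gt_eqF.
have b0 : 0 < b by rewrite bE divr_gt0.
have b1 : 0 < 1 - b.
  rewrite bE -[X in X - _](divff (lt0r_neq0 rho1)) -mulrBl /rho addrAC subrr add0r.
  by rewrite divr_gt0.
pose c := g / (b * (1 - b)).
have rhoc n : rho n = rho 0 * c ^+ n.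
  elim: n => [|n IH]; first by rewrite expr0 mulr1.
  have nz : b * (1 - b) != 0 by rewrite mulf_neq0 // gt_eqF.
  rewrite exprSr mulrA -IH; apply: (mulfI nz); rewrite rhoS /c.
  by rewrite [in RHS]mulrCA [X in rho n * X]mulrC divfK // mulrC.
have rho00 : 0 < rho 0.
  by rewrite /rho -tXa a0 mulr1 -tYd d0 mulr1 -linearD.
(* [rho 0] is the mean of [S] and [rho 1] the sum of the two variances, so the mean of [S] decides
   the sign of the scale. *)
have c0 : 0 < c.
  have -> : c = rho 1 / rho 0 by rewrite [in RHS](rhoc 1) expr1 [_ * c]mulrC mulfK ?gt_eqF.
  by rewrite divr_gt0.
have real_pos (z : R[i]) : 0 < z -> exists2 t : R, 0 < t & z = t%:C.
  by case: z => u v; rewrite ltcE /= => /andP[/eqP -> u0]; exists u.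
have [c' c'0 cE] := real_pos _ c0.
have [m m0 mE] : exists2 t : R, 0 < t & b * rho 0 = t%:C.
  by apply: real_pos; rewrite mulr_gt0.
have [m' m'0 m'E] : exists2 t : R, 0 < t & (1 - b) * rho 0 = t%:C.
  by apply: real_pos; rewrite mulr_gt0.
exists c', m, m'; split=> //; rewrite -cE -?mE -?m'E.
  apply: (appell_moments _ a) => // n; rewrite aS; congr (_ - _).
  by apply: eq_bigr => k _; rewrite rE rhoc mulrA.
(* [Y] takes the share [1 - b] of each cumulant of [S], with the same ratio. *)
apply: (appell_moments _ d) => // n; rewrite dS; congr (_ - _).
apply: eq_bigr => k _; congr (_ *: _).
by rewrite -mulrA -rhoc mulrBl mul1r -rE /rho addrAC subrr add0r.
Qed.

End LukacsMoments.

(** * The Marchenko-Pastur law *)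

Section DensityMeasure.
Context {R : realType}.
Local Notation leb := (@lebesgue_measure R).
Variable p : R -> R.
Hypotheses (mp : measurable_fun setT p) (p_ge0 : forall x, 0 <= p x)
  (p1 : (\int[leb]_x (p x)%:E = 1)%E).

Definition density_measure (U : set (measurableTypeR R)) : \bar R :=
  (\int[leb]_(x in U) (p x)%:E)%E.

Let density0 : density_measure set0 = 0%E.
Proof. by rewrite /density_measure integral_set0. Qed.

Let density_ge0 U : (0 <= density_measure U)%E.
Proof. by apply: integral_ge0 => x _; rewrite lee_fin. Qed.

Let density_integrable : leb.-integrable setT (EFin \o p).
Proof.
apply/integrableP; split; first exact/measurable_EFinP.
under eq_integral => x _ do rewrite /= ger0_norm //.
by rewrite p1 ltry.
Qed.

Let density_sigma_additive : semi_sigma_additive density_measure.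
Proof.
move=> /= F mF tF mUF; rewrite /density_measure; apply: cvg_toP.
  apply: ereal_nondecreasing_is_cvgn => m n mn.
  apply: lee_sum_nneg_natr => // k _ _; exact: density_ge0.
rewrite ge0_integral_bigcup //=; last by move=> x _; rewrite lee_fin.
exact/measurable_funTS/measurable_EFinP.
Qed.

HB.instance Definition _ := isMeasure.Build _ _ _
  density_measure density0 density_ge0 density_sigma_additive.

HB.instance Definition _ :=
  @Measure_isProbability.Build _ _ R density_measure p1.

Let density_dominates : density_measure `<< leb.
Proof.
apply/null_content_dominatesP => U mU U0.
by apply: null_set_integral => //; exact/measurable_funTS/measurable_EFinP.
Qed.

(** The Radon-Nikodym derivative of the measure is almost everywhere [p], both having the same
    integral over every measurable set. *)
Lemma integral_density_measure (f : R -> \bar R) : density_measure.-integrable setT f ->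
  (\int[density_measure]_x f x = \int[leb]_x (f x * (p x)%:E))%E.
Proof.
move=> intf; have mf := measurable_int _ intf.
rewrite -(Radon_Nikodym_change_of_variables density_dominates) //=.
apply: ae_eq_integral => //.
- apply: emeasurable_funM; first exact: mf.
  apply: (measurable_int leb).
  by apply: Radon_Nikodym_integrable; exact: density_dominates.
- by apply: emeasurable_funM; [exact: mf|exact/measurable_EFinP].
- apply: ae_eqe_mul2l => /=.
  rewrite Radon_NikodymE /=; case: cid => /= h [h1 h2 h3].
  apply: integral_ae_eq => //=; first exact/measurable_EFinP.
  by move=> E ET mE; rewrite -h3.
Qed.

End DensityMeasure.

Lemma density_pushforward (R : realType) (p g : R -> R) :
  measurable_fun setT p -> (forall x, 0 <= p x) ->
  (\int[@lebesgue_measure R]_x (p x)%:E = 1)%E -> measurable_fun setT g ->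
  exists nu : probability (measurableTypeR R) R, forall F : R -> R,
    measurable_fun setT F -> (exists M, forall x, `|F (g x)| <= M) ->
    nu.-integrable setT (EFin \o F) /\
    \int[nu]_t F t = \int[@lebesgue_measure R]_x (F (g x) * p x).
Proof.
move=> mp p0 p1 mg.
have mg' : @measurable_fun _ _ (measurableTypeR R) (measurableTypeR R) setT g := mg.
pose X : {mfun (measurableTypeR R) >-> (measurableTypeR R)} :=
  @mfun_Sub _ _ (measurableTypeR R) (measurableTypeR R) g (mem_set mg').
pose dens : probability (measurableTypeR R) R := density_measure p.
pose P := dens mp p0 p1.
exists (distribution P X) => F mF [M FM].
have iFg : P.-integrable setT ((EFin \o F) \o X).
  apply: measurable_bounded_integrable => //.
  - by have := @probability_setT _ _ _ P; rewrite /P /dens /= => ->; rewrite ltry.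
  - exact: measurableT_comp.
  - exists M; split => //; first by rewrite num_real.
    by move=> y My x _ /=; rewrite (le_trans (FM x)) // ltW.
split.
  apply: integrable_pushforward => //; exact/measurable_EFinP.
rewrite /Rintegral integral_distribution //; last exact/measurable_EFinP.
by rewrite integral_density_measure.
Qed.

(** * Trigonometric integrals over [[0, pi]] *)

Section HalfPeriodIntegral.
Context {R : realType}.
Local Notation leb := (@lebesgue_measure R).
Implicit Types (f g : R -> R) (w : R[i]).

Definition int0pi f : R := \int[leb]_(x in `[0, pi]) f x.

Lemma integrable0pi f : continuous f -> leb.-integrable `[0, pi] (EFin \o f).
Proof.
move=> cf; apply: continuous_compact_integrable; first exact: segment_compact.
exact: continuous_subspaceT.
Qed.

Lemma eq_int0pi f g : f =1 g -> int0pi f = int0pi g.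
Proof. by move=> fg; apply: eq_Rintegral => x _; rewrite fg. Qed.

Lemma int0piD f g : continuous f -> continuous g ->
  int0pi (fun x => f x + g x) = int0pi f + int0pi g.
Proof. by move=> cf cg; rewrite /int0pi RintegralD //; exact: integrable0pi. Qed.

Lemma int0piZ f k : continuous f -> int0pi (fun x => k * f x) = k * int0pi f.
Proof. by move=> cf; rewrite /int0pi RintegralZl //; exact: integrable0pi. Qed.

Lemma continuousZ f k : continuous f -> continuous (fun x => k * f x).
Proof. by move=> cf x; apply: cvgM; [exact: cvg_cst|exact: cf]. Qed.

Lemma continuous_sum n (F : nat -> R -> R) : (forall k, continuous (F k)) ->
  continuous (fun x => \sum_(k < n) F k x).
Proof.
move=> cF; elim: n => [|n IH] x.
  rewrite (_ : (fun x => _) = cst 0); first exact: cvg_cst.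
  by apply/funext => y; rewrite big_ord0.
rewrite (_ : (fun x => _) = (fun x => \sum_(k < n) F k x + F n x)); last first.
  by apply/funext => y; rewrite big_ord_recr.
exact: (cvgD (IH x) (cF n x)).
Qed.

Lemma int0pi_sum n (F : nat -> R -> R) : (forall k, continuous (F k)) ->
  int0pi (fun x => \sum_(k < n) F k x) = \sum_(k < n) int0pi (F k).
Proof.
move=> cF; elim: n => [|n IH].
  rewrite big_ord0 (eq_int0pi _ (fun=> 0 * 0)) => [|x]; last by rewrite big_ord0 mul0r.
  by rewrite int0piZ ?mul0r // => x; exact: cvg_cst.
rewrite big_ord_recr /= -IH -int0piD //; last exact: continuous_sum.
by apply: eq_int0pi => x; rewrite big_ord_recr.
Qed.

Lemma int0pi_cst k : int0pi (fun=> k) = k * pi.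
Proof.
by rewrite /int0pi Rintegral_cst //= lebesgue_measure_itv /= lte_fin pi_gt0 oppr0 addr0.
Qed.

Lemma int0pi_le f g : continuous f -> continuous g ->
  (forall x, f x <= g x) -> int0pi f <= int0pi g.
Proof. by move=> cf cg fg; apply: le_Rintegral => //; exact: integrable0pi. Qed.

Lemma int0pi_bound f M : continuous f -> (forall x, `|f x| <= M) ->
  `|int0pi f| <= M * pi.
Proof.
move=> cf fM; have cM k : continuous (fun _ : R => k : R) by move=> k' x; exact: cvg_cst.
rewrite ler_norml -mulNr -!int0pi_cst.
by apply/andP; split; apply: int0pi_le => // x; have := fM x; rewrite ler_norml => /andP[].
Qed.

Lemma sin_natmul_pi n : sin (n%:R * pi) = 0 :> R.
Proof.
by elim: n => [|n IH]; rewrite ?mul0r ?sin0 // -natr1 mulrDl mul1r sinDpi IH oppr0.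
Qed.

Lemma continuous_sin_mul (k : R) : continuous (fun x => sin (k * x)).
Proof.
move=> x; apply: (@continuous_comp _ _ _ (fun x => k * x) sin).
  by apply: continuousZ => y; exact: cvg_id.
exact: continuous_sin.
Qed.

Lemma continuous_cos_mul (k : R) : continuous (fun x => cos (k * x)).
Proof.
move=> x; apply: (@continuous_comp _ _ _ (fun x => k * x) cos).
  by apply: continuousZ => y; exact: cvg_id.
exact: continuous_cos.
Qed.

Lemma int0pi_cos n : int0pi (fun x => cos (n%:R * x)) = (n == 0%N)%:R * pi.
Proof.
case: n => [|n] /=.
  rewrite mul1r (eq_int0pi _ (fun=> 1)) ?int0pi_cst ?mul1r // => x.
  by rewrite mul0r cos0.
have n0 : n.+1%:R != 0 :> R by rewrite pnatr_eq0.
pose F x : R := n.+1%:R^-1 * sin (n.+1%:R * x).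
have dF (x : R) : is_derive x (1 : R) F (cos (n.+1%:R * x)).
  have -> : F = n.+1%:R^-1 \*: (sin \o (n.+1%:R \*: (@id R^o))) by apply/funext.
  have -> : cos (n.+1%:R * x) =
      n.+1%:R^-1 *: (cos (n.+1%:R * x) * (n.+1%:R *: (1 : R^o))).
    by rewrite /GRing.scale /= mulr1 mulrCA mulVf // mulr1.
  apply: is_deriveZ; apply: is_derive1_comp; exact: is_deriveZ.
rewrite mul0r /int0pi /Rintegral (@continuous_FTC2 _ _ F) //.
- by rewrite -EFinB /F sin_natmul_pi !mulr0 sin0 mulr0 subrr.
- exact: pi_gt0.
- by apply: continuous_subspaceT; exact: continuous_cos_mul.
- have cF : continuous F by apply: continuousZ; exact: continuous_sin_mul.
  split; last 2 first.
  + by apply: cvg_at_right_filter; exact: cF.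
  + by apply: cvg_at_left_filter; exact: cF.
  + by move=> x _; apply: ex_derive.
- by move=> x _; rewrite derive1E derive_val.
Qed.

Lemma sin_mul_sin n (x : R) : sin x * sin (n.+1%:R * x) =
  2^-1 * cos (n%:R * x) + (- 2^-1) * cos (n.+2%:R * x).
Proof.
have -> : n%:R * x = n.+1%:R * x - x by rewrite -natr1 mulrDl mul1r addrK.
have -> : n.+2%:R * x = n.+1%:R * x + x by rewrite -(natr1 n.+1) mulrDl mul1r.
by rewrite cosB cosD; set k := n.+1%:R; field.
Qed.

Lemma int0pi_sin_sin n :
  int0pi (fun x => sin x * sin (n.+1%:R * x)) = (n == 0%N)%:R * (pi / 2).
Proof.
have cc k := @continuous_cos_mul k; have cz l k := continuousZ _ l (cc k).
rewrite (eq_int0pi _ _ (sin_mul_sin n)) int0piD ?int0piZ //.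
by rewrite !int0pi_cos /= mul0r mulr0 addr0 mulrCA [_^-1 * _]mulrC.
Qed.

End HalfPeriodIntegral.

Section ResolventIntegral.
Context {R : realType}.
Implicit Types (w k : R[i]) (x : R).

(** This is [(1 - w e^(ix)) (1 - w e^(-ix))], the denominator of the generating function of the
    Chebyshev polynomials of the second kind at [cos x]. *)
Definition cos_den w x : R[i] := 1 - 2 * w * (cos x)%:C + w ^+ 2.

Lemma normrC_ReE (z : R[i]) : `|z| = (complex.Re `|z|)%:C.
Proof. by rewrite RRe_real // normr_real. Qed.

Lemma cos_den_norm w x : `|w| < 1 -> (1 - `|w|) ^+ 2 <= `|cos_den w x|.
Proof.
move=> w1; pose e : R[i] := cos x +i* sin x; pose e' : R[i] := cos x -i* sin x.
have ee' : e * e' = 1.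
  apply/eqP; rewrite eq_complex /= mulrN opprK -!expr2 cos2Dsin2.
  by rewrite mulrC addrC mulNr mulrC subrr !eqxx.
have De : e + e' = 2 * (cos x)%:C.
  by apply/eqP; rewrite eq_complex /=; apply/andP; split; apply/eqP; ring.
have -> : cos_den w x = (1 - w * e) * (1 - w * e').
  have -> : cos_den w x = 1 - w * (e + e') + w ^+ 2 * (e * e').
    by rewrite ee' De /cos_den; ring.
  by ring.
have ne : `|e| = 1 by rewrite normc_def /= cos2Dsin2 sqrtr1.
have ne' : `|e'| = 1 by rewrite normc_def /= sqrrN cos2Dsin2 sqrtr1.
have w0 : 0 <= 1 - `|w| by rewrite subr_ge0 ltW.
rewrite normrM expr2 ler_pM //.
  by rewrite (le_trans _ (lerB_dist _ _)) // normr1 normrM ne mulr1.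
by rewrite (le_trans _ (lerB_dist _ _)) // normr1 normrM ne' mulr1.
Qed.

Lemma cos_den_neq0 w x : `|w| < 1 -> cos_den w x != 0.
Proof.
move=> w1; rewrite -normr_gt0 (lt_le_trans _ (cos_den_norm _ x w1)) //.
by rewrite exprn_gt0 // subr_gt0.
Qed.

Lemma sin_sum_rec n x : sin (n.+2%:R * x) + sin (n%:R * x) =
  2 * cos x * sin (n.+1%:R * x).
Proof.
have -> : n%:R * x = n.+1%:R * x - x by rewrite -natr1 mulrDl mul1r addrK.
have -> : n.+2%:R * x = n.+1%:R * x + x by rewrite -(natr1 n.+1) mulrDl mul1r.
by rewrite sinB sinD; set k := n.+1%:R; ring.
Qed.

(** Finite form of [sum_j w^j sin ((j + 1) x) = sin x / cos_den w x]. The explicit remainder lets a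
    uniform bound take the place of exchanging series and integral. *)
Lemma chebyshev_partial_sum w x n :
  (\sum_(j < n) w ^+ j * (sin (j.+1%:R * x))%:C) * cos_den w x =
  (sin x)%:C - w ^+ n * (sin (n.+1%:R * x))%:C + w ^+ n.+1 * (sin (n%:R * x))%:C.
Proof.
elim: n => [|n IH].
  by rewrite big_ord0 mul0r mul0r sin0 mulr0 addr0 expr0 !mul1r subrr.
rewrite big_ord_recr /= mulrDl IH.
have -> : (sin (n.+2%:R * x))%:C =
    2 * (cos x)%:C * (sin (n.+1%:R * x))%:C - (sin (n%:R * x))%:C.
  rewrite -[n.+2%:R * x in LHS]/(_) -[sin (n.+2%:R * x)](addrK (sin (n%:R * x))) sin_sum_rec.
  by rewrite rmorphB !rmorphM rmorph_nat.
by rewrite /cos_den !exprS; ring.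
Qed.

Lemma continuous_Re_div (k : R[i]) (u v : R -> R) :
  continuous u -> continuous v -> (forall x, u x +i* v x != 0) ->
  continuous (fun x => complex.Re (k / (u x +i* v x))).
Proof.
move=> cu cv uv0.
have E x : complex.Re (k / (u x +i* v x)) =
    (complex.Re k * u x + complex.Im k * v x) * (u x * u x + v x * v x)^-1.
  case: k => k1 k2 /=; rewrite !expr2; set d := (_ + _)^-1.
  by ring.
rewrite (_ : (fun x => _) = fun x =>
  (complex.Re k * u x + complex.Im k * v x) * (u x * u x + v x * v x)^-1); last first.
  exact/funext.
move=> x; apply: cvgM.
  by apply: cvgD; apply: cvgM; [exact: cvg_cst|exact: cu|exact: cvg_cst|exact: cv].
apply: cvgV; last by apply: cvgD; apply: cvgM; [exact: cu|exact: cu|exact: cv|exact: cv].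
have := uv0 x; apply: contraNneq => /eqP.
rewrite -!expr2 paddr_eq0 ?sqr_ge0 // !sqrf_eq0 => /andP[/eqP -> /eqP ->].
by rewrite eq_complex /= !eqxx.
Qed.

Lemma continuous_cos_den k w : `|w| < 1 ->
  continuous (fun x => complex.Re (k / cos_den w x)).
Proof.
move=> w1; pose u x := 1 + complex.Re (w ^+ 2) + (- (2 * complex.Re w)) * cos x.
pose v x := complex.Im (w ^+ 2) + (- (2 * complex.Im w)) * cos x.
have E x : cos_den w x = u x +i* v x.
  rewrite /cos_den /u /v; case: w {w1 u v} => a b; apply/eqP; rewrite eq_complex /=.
  by apply/andP; split; apply/eqP; ring.
rewrite (_ : (fun x => _) = fun x => complex.Re (k / (u x +i* v x))); last first.
  by apply/funext => x; rewrite E.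
apply: continuous_Re_div => [x|x|x]; last by rewrite -E cos_den_neq0.
- by apply: cvgD; [exact: cvg_cst|apply: cvgM; [exact: cvg_cst|exact: continuous_cos]].
- by apply: cvgD; [exact: cvg_cst|apply: cvgM; [exact: cvg_cst|exact: continuous_cos]].
Qed.

Lemma geometric_bound_eq0 (d C r : R) : 0 <= r < 1 ->
  (forall n, `|d| <= C * r ^+ n) -> d = 0.
Proof.
move=> /andP[r0 r1] dr; apply/eqP; rewrite -normr_le0.
have : (fun n => C * r ^+ n) @ \oo --> C * 0.
  by apply: cvgM; [exact: cvg_cst|apply: cvg_expr; rewrite ger0_norm].
rewrite mulr0 => cv; rewrite -(cvg_lim _ cv) //; apply: limr_ge.
  by apply/cvg_ex; exists 0.
by near=> n; exact: dr.
Unshelve. all: by end_near.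
Qed.

Lemma Re_realM (r : R) (z : R[i]) : complex.Re (r%:C * z) = r * complex.Re z.
Proof. by case: z => a b /=; rewrite mul0r subr0. Qed.

Lemma Re_sub (z z' : R[i]) : complex.Re (z - z') = complex.Re z - complex.Re z'.
Proof. by case: z z' => [? ?] [? ?]. Qed.

Lemma Re_sum n (f : 'I_n -> R[i]) :
  complex.Re (\sum_(j < n) f j) = \sum_(j < n) complex.Re (f j).
Proof. by apply: big_morph => // -[? ?] [? ?]. Qed.

(* For k = w and z = w + 1/w the quotient is 1/(z - 2 cos x), so this computes the Cauchy
   transform of the semicircle law; the imaginary part is obtained by rotating k. *)
Lemma int0pi_resolvent k w : `|w| < 1 ->
  int0pi (fun x => sin x ^+ 2 * complex.Re (k / cos_den w x)) =
  complex.Re k * (pi / 2).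
Proof.
move=> w1; set F := fun x => _.
have cs : continuous (fun x : R => sin x) by exact: continuous_sin.
have cF : continuous F.
  move=> x; apply: cvgM; last exact: continuous_cos_den.
  by rewrite /=; under eq_fun => y do rewrite expr2; apply: cvgM; exact: cs.
pose P n x := complex.Re (k * w ^+ n) * (sin x * sin (n.+1%:R * x)).
have cP n : continuous (P n).
  apply: continuousZ => x; apply: cvgM; [exact: cs|exact: continuous_sin_mul].
have intP n : int0pi (P n) = complex.Re (k * w ^+ n) * ((n == 0%N)%:R * (pi / 2)).
  rewrite int0piZ ?int0pi_sin_sin // => x.
  by apply: cvgM; [exact: cs|exact: continuous_sin_mul].
have r0 : 0 <= complex.Re `|w| < 1.
  have := normr_ge0 w; rewrite {1}normrC_ReE ler0c => ->.
  by move: w1; rewrite {1}normrC_ReE -[1]/(1%:C) ltcR.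
(* For the remainder: 2 bounds the combination of two sines, [(1 - |w|)^-2] bounds the inverse of
   [cos_den], and [pi] is the length of the interval. *)
pose C := complex.Re (`|k| * (2 / (1 - `|w|) ^+ 2)) * pi.
apply/eqP; rewrite -subr_eq0; apply/eqP.
apply: (@geometric_bound_eq0 _ C (complex.Re `|w|)) => // n.
have restE x : F x - \sum_(j < n.+1) P j x =
    complex.Re (k * w ^+ n.+1 * ((sin x)%:C *
      ((sin (n.+2%:R * x))%:C - w * (sin (n.+1%:R * x))%:C)) / cos_den w x).
  have d0 := cos_den_neq0 _ x w1.
  have -> : \sum_(j < n.+1) P j x = complex.Re ((sin x)%:C * k *
      (\sum_(j < n.+1) w ^+ j * (sin (j.+1%:R * x))%:C)).
    rewrite mulr_sumr Re_sum; apply: eq_bigr => j _.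
    rewrite /P mulrC -Re_realM; congr complex.Re; rewrite rmorphM; ring.
  rewrite /F -Re_realM -Re_sub; congr complex.Re.
  apply: (mulIf d0); rewrite divfK // mulrBl mulrA divfK // -[_ * k * _ * _]mulrA.
  rewrite chebyshev_partial_sum.
  by rewrite rmorphXn !exprS; ring.
have -> : int0pi F - complex.Re k * (pi / 2) = int0pi (fun x => F x - \sum_(j < n.+1) P j x).
  have -> : int0pi (fun x => F x - \sum_(j < n.+1) P j x) =
      int0pi (fun x => F x + (-1) * \sum_(j < n.+1) P j x).
    by apply: eq_int0pi => x; rewrite mulN1r.
  rewrite int0piD ?int0piZ ?int0pi_sum //; last 2 first.
  - exact: continuous_sum.
  - by apply: continuousZ; exact: continuous_sum.
  (* By orthogonality of the sines only the term [j = 0] has a nonzero integral, and it is the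
     claimed value. *)
  rewrite mulN1r big_ord_recl /= intP expr0 mulr1 mul1r big1 ?addr0 // => j _.
  by rewrite intP mul0r mulr0.
rewrite /C mulrAC; apply: int0pi_bound => [x|x].
  by apply: cvgB; [exact: cF|exact: continuous_sum].
rewrite restE -lecR; apply: le_trans (normc_ge_Re _) _.
have n1 (r : R) : `|r| <= 1 -> `|r%:C : R[i]| <= 1.
  by move=> hr; rewrite normc_def /= expr0n addr0 sqrtr_sqr -[1]/(1%:C) lecR.
have rC (r : R) : 0 <= r -> `|r%:C : R[i]| = r%:C.
  by move=> hr; rewrite ger0_norm // ler0c.
have cM (a b : R) : (a * b)%:C = a%:C * b%:C by rewrite rmorphM.
have cX (a : R) m : (a ^+ m)%:C = a%:C ^+ m by rewrite rmorphXn.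
rewrite cM cX -normrC_ReE RRe_real; last first.
  by rewrite rpredM ?normr_real // rpredM ?rpredV ?rpredX ?rpredB ?rpred1 ?normr_real ?rpred_nat.
set a := (sin x)%:C; set b := (_ - _ * _).
have -> : `|k * w ^+ n.+1 * (a * b) / cos_den w x| =
    `|k| * `|w| ^+ n * (`|w| * (`|a| * `|b|) / `|cos_den w x|).
  by rewrite normrM normfV !normrM normrX exprSr; ring.
rewrite [X in _ <= X]mulrAC; apply: ler_wpM2l; first by rewrite mulr_ge0 ?exprn_ge0.
apply: ler_pM; rewrite ?invr_ge0 ?mulr_ge0 //; last first.
  by rewrite lef_pV2 ?cos_den_norm ?posrE ?exprn_gt0 ?subr_gt0 // normr_gt0 cos_den_neq0.
have b2 : `|b| <= 2.
  rewrite (le_trans (ler_normB _ _)) // -[2]/(1 + 1) lerD ?n1 ?sin_max // normrM.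
  by rewrite mulr_ile1 ?n1 ?sin_max // ltW.
apply: le_trans (ler_piMl _ (ltW w1)) _; first by rewrite mulr_ge0.
by apply: le_trans (ler_piMl _ (n1 _ (sin_max x))) _.
Qed.

End ResolventIntegral.

Section MarchenkoPastur.
Context {R : realType}.
Local Notation leb := (@lebesgue_measure R).
Variable q : R.
Hypothesis q0 : 0 < q.
Implicit Types (x : R).

(* This is |1 + q e^(ix)|^2, which on [0, pi] vanishes only for q = 1 and x = pi. *)
Definition mp_point x : R := 1 + q ^+ 2 + 2 * q * cos x.

(* The value at q = 1 is the continuous extension of the other formula. *)
Definition mp_density x : R :=
  if q == 1 then pi^-1 * (1 - cos x)
  else 2 / pi * q ^+ 2 * sin x ^+ 2 / mp_point x.

(** For [q ^+ 2 < 1] the Marchenko-Pastur law has an atom of mass [1 - q ^+ 2] at 0; this is the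
    mass of the part with a density. *)
Definition mp_mass : R := if q < 1 then q ^+ 2 else 1.

Lemma mp_point_gt0 x : q != 1 -> 0 < mp_point x.
Proof.
move=> q1; have -> : mp_point x = (1 - q) ^+ 2 + 2 * q * (1 + cos x).
  by rewrite /mp_point; ring.
apply: ltr_pwDl; first by rewrite exprn_even_gt0 //= subr_eq0 eq_sym.
have c0 : 0 <= 1 + cos x by have := cos_geN1 x; lra.
by rewrite !mulr_ge0 // ltW.
Qed.

(** Stated as a product, so that it covers [q = 1] and [x = pi], where [mp_point] vanishes. *)
Lemma mp_densityM x : mp_density x * mp_point x = 2 / pi * q ^+ 2 * sin x ^+ 2.
Proof.
have pi0 : pi != 0 :> R by rewrite gt_eqF ?pi_gt0.
rewrite /mp_density; case: eqP => [q1|/eqP q1]; last by rewrite divfK // gt_eqF ?mp_point_gt0.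
by rewrite sin2cos2 /mp_point q1; move: (@pi R) pi0 => P P0; field.
Qed.

Lemma mp_density_ge0 x : 0 <= mp_density x.
Proof.
rewrite /mp_density; case: eqP => [q1|/eqP q1].
  by rewrite mulr_ge0 ?invr_ge0 ?pi_ge0 // subr_ge0 cos_le1.
have t0 := ltW (mp_point_gt0 x q1).
by rewrite divr_ge0 // mulr_ge0 ?sqr_ge0 // mulr_ge0 ?sqr_ge0 // divr_ge0 ?pi_ge0.
Qed.

Lemma continuous_mp_point : continuous mp_point.
Proof.
move=> x; apply: cvgD; first exact: cvg_cst.
by apply: cvgM; [exact: cvg_cst|exact: continuous_cos].
Qed.

Lemma continuous_sin2 : continuous (fun x : R => sin x ^+ 2).
Proof. by move=> x; under eq_fun => y do rewrite expr2; apply: cvgM; exact: continuous_sin. Qed.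

Lemma continuous_mp_density : continuous mp_density.
Proof.
rewrite /mp_density; case: eqP => [q1|/eqP q1] x.
  apply: cvgM; first exact: cvg_cst.
  by apply: cvgB; [exact: cvg_cst|exact: continuous_cos].
apply: cvgM; first by apply: cvgM; [exact: cvg_cst|exact: continuous_sin2].
by apply: cvgV; [rewrite gt_eqF ?mp_point_gt0|exact: continuous_mp_point].
Qed.

Lemma normC_real_lt1 (r : R) : `|r| < 1 -> `|r%:C : R[i]| < 1.
Proof. by move=> r1; rewrite normc_def /= expr0n addr0 sqrtr_sqr -[1]/(1%:C) ltcR. Qed.

(** [mp_point x] equals [cos_den] at [- q], and also [q ^+ 2] times [cos_den] at [- q^-1]. For
    [q != 1] one of the two parameters lies in the unit disc, and the factor [q ^+ 2] makes the
    difference between the two values of [mp_mass]. *)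
Lemma int0pi_mp_density : int0pi mp_density = mp_mass.
Proof.
have pi0 : pi != 0 :> R by rewrite gt_eqF ?pi_gt0.
have key (r k : R) : `|r| < 1 ->
    (forall x, mp_density x = k * (sin x ^+ 2 * (1 - 2 * r * cos x + r ^+ 2)^-1)) ->
    int0pi mp_density = k * (pi / 2).
  move=> r1 dE; have w1 := normC_real_lt1 _ r1.
  rewrite (eq_int0pi _ (fun x => k * (sin x ^+ 2 * complex.Re (1 / cos_den r%:C x)))).
    rewrite int0piZ; first by rewrite int0pi_resolvent // mul1r.
    by move=> x; apply: cvgM; [exact: continuous_sin2|exact: continuous_cos_den].
  move=> x; rewrite dE; congr (_ * (_ * _)); rewrite div1r.
  have -> : cos_den r%:C x = (1 - 2 * r * cos x + r ^+ 2)%:C.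
    by apply/eqP; rewrite eq_complex /=; apply/andP; split; apply/eqP; ring.
  by rewrite -fmorphV.
rewrite /mp_mass; case: (ltgtP q 1) => [q1|q1|q1].
- rewrite (key (- q) (2 / pi * q ^+ 2)).
  + by move: (@pi R) pi0 => P P0; field; rewrite P0.
  + by rewrite normrN ger0_norm // ltW.
  + move=> x; rewrite /mp_density lt_eqF // -mulrA; congr (_ * (_ / _)).
    by rewrite /mp_point; ring.
- have qn0 : q != 0 by rewrite gt_eqF.
  rewrite (key (- q^-1) (2 / pi)).
  + by move: (@pi R) pi0 => P P0; field; rewrite P0.
  + by rewrite normrN ger0_norm ?invr_ge0 ?ltW // invf_lt1.
  + move=> x; rewrite /mp_density gt_eqF //.
    have p0 : mp_point x != 0 by rewrite gt_eqF ?mp_point_gt0 // gt_eqF.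
    have -> : 1 - 2 * - q^-1 * cos x + (- q^-1) ^+ 2 = mp_point x / q ^+ 2.
      by rewrite /mp_point; field.
    by move: (mp_point x) p0 (@pi R) pi0 => m m0 P P0; field; rewrite qn0 m0 P0.
- rewrite /mp_density q1 eqxx; set f := fun x => _.
  have cc : continuous (fun x : R => cos (1%:R * x)) by exact: continuous_cos_mul.
  rewrite (eq_int0pi _ (fun x => pi^-1 * (1 + (-1) * cos (1%:R * x)))); last first.
    by move=> x; rewrite /f mul1r mulN1r.
  rewrite int0piZ ?int0piD ?int0piZ ?int0pi_cos ?int0pi_cst //.
  + by rewrite mul0r mulr0 addr0 mul1r mulVf.
  + by move=> x; exact: cvg_cst.
  + by apply: continuousZ.
  + by move=> x; apply: cvgD; [exact: cvg_cst|exact: continuousZ].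
Qed.

Lemma mp_atom_ge0 : 0 <= 1 - mp_mass.
Proof.
rewrite subr_ge0 /mp_mass; case: ifP => // q1.
by rewrite expr_le1 // ltW.
Qed.

(* The atom at 0 is carried by the interval ]pi, pi + 1]. *)
Lemma mp_law : exists nu : probability (measurableTypeR R) R,
  forall F : R -> R, continuous F ->
  nu.-integrable setT (EFin \o F) /\
  \int[nu]_t F t =
    int0pi (fun x => F (mp_point x) * mp_density x) + (1 - mp_mass) * F 0.
Proof.
pose I1 : set R := `[0, pi]%classic; pose I2 : set R := `]pi, pi + 1]%classic.
pose p x := mp_density x * \1_I1 x + (1 - mp_mass) * \1_I2 x.
(* Off [[0, pi]] this is 0, so the constant density on [I2] is pushed to the atom. *)
pose g x := mp_point x * \1_I1 x.
have mI1 : measurable (I1 : set (measurableTypeR R)) by exact: measurable_itv.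
have mI2 : measurable (I2 : set (measurableTypeR R)) by exact: measurable_itv.
have m1 : measurable_fun [set: R] (\1_I1 : R -> R) by exact: measurable_indic.
have m2 : measurable_fun [set: R] (\1_I2 : R -> R) by exact: measurable_indic.
have mp : measurable_fun setT p.
  apply: measurable_funD; apply: measurable_funM => //.
  exact: continuous_measurable_fun continuous_mp_density.
have mg : measurable_fun setT g.
  apply: measurable_funM => //.
  exact: continuous_measurable_fun continuous_mp_point.
have p0 x : 0 <= p x.
  by rewrite addr_ge0 // mulr_ge0 ?mp_density_ge0 ?mp_atom_ge0 // indicE.
have I12 x : I2 x -> ~ I1 x.
  by rewrite /I1 /I2 /= !in_itv /= => /andP[x1 _] /andP[_]; rewrite leNgt x1.
have split_int (G : R -> R) : continuous G ->
    leb.-integrable setT (EFin \o (fun x => G x * \1_I1 x)) /\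
    \int[leb]_x (G x * \1_I1 x) = int0pi G.
  move=> cG; have -> : (fun x => G x * \1_I1 x) = G \_ I1 by rewrite patch_indic.
  rewrite /int0pi [in RHS]Rintegral_mkcond; split=> //.
  rewrite -restrict_EFin; apply/integrable_restrict => //.
  by rewrite setTI; exact: integrable0pi.
have split_cst (k : R) :
    leb.-integrable setT (EFin \o (fun x => k * \1_I2 x)) /\
    \int[leb]_x (k * \1_I2 x) = k.
  have -> : (fun x => k * \1_I2 x) = (fun=> k) \_ I2 by rewrite patch_indic.
  split; last first.
    rewrite -Rintegral_mkcond Rintegral_cst // /I2 /= lebesgue_measure_itv /= lte_fin.
    by rewrite ltrDl ltr01 /= addrAC subrr add0r mulr1.
  rewrite -restrict_EFin; apply/integrable_restrict => //; rewrite setTI.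
  apply: (@integrableS _ _ _ leb `[pi, pi + 1]%classic) => //.
    by apply: subset_itvr; rewrite bnd_simp.
  apply: continuous_compact_integrable; first exact: segment_compact.
  by apply: continuous_subspaceT => x; exact: cvg_cst.
have p1 : (\int[leb]_x (p x)%:E = 1)%E.
  have [i1 e1] := split_int _ continuous_mp_density.
  have [i2 e2] := split_cst (1 - mp_mass).
  have ip : leb.-integrable setT (EFin \o p).
    by apply: eq_integrable (integrableD measurableT i1 i2) => // x _ /=; rewrite EFinD.
  have E : \int[leb]_x p x = 1.
    by rewrite RintegralD // e1 e2 int0pi_mp_density addrC subrK.
  rewrite -[LHS]fineK; last exact: integrable_fin_num.
  by move: E; rewrite /Rintegral => ->.
have [nu nuP] := density_pushforward _ _ _ mp p0 p1 mg.
exists nu => F cF; have mF : measurable_fun setT F by exact: continuous_measurable_fun.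
pose c := 1 + q ^+ 2 + 2 * q.
have gc x : g x \in `[- c, c].
  have c0 : 0 <= c by rewrite /c; have := sqr_ge0 q; have := ltW q0; lra.
  rewrite /g indicE; case: (x \in I1); rewrite ?mulr0 ?mulr1 in_itv /= -ler_norml.
    rewrite ler_norml /mp_point /c; have := cos_geN1 x; have := cos_le1 x.
    by have := sqr_ge0 q; have := ltW q0; nra.
  by rewrite normr0.
have [|iF ->] := nuP F mF.
  have wF : {within `[- c, c], continuous F} by exact: continuous_subspaceT.
  have /compact_bounded[M [_ MP]] := continuous_compact wF (@segment_compact _ _ _).
  exists (M + 1) => x; apply: (MP (M + 1)); first by rewrite ltrDl.
  by exists (g x) => //; exact: gc.
split=> //.
have cFd : continuous (fun x => F (mp_point x) * mp_density x).
  move=> x; apply: cvgM; last exact: continuous_mp_density.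
  by apply: (@continuous_comp _ _ _ mp_point F); [exact: continuous_mp_point|exact: cF].
have [i1 <-] := split_int _ cFd; have [i2 <-] := split_cst ((1 - mp_mass) * F 0).
rewrite -RintegralD //; apply: eq_Rintegral => x _.
rewrite /g /p !indicE; case: (boolP (x \in I1)) => [x1|x1].
  rewrite (_ : x \in I2 = false) ?mulr0 ?addr0 ?mulr1 //.
  by apply/negP => /set_mem/I12; apply; exact: set_mem.
by rewrite !mulr0 !add0r mulrCA mulrA.
Qed.

End MarchenkoPastur.

(** * Moments and free cumulants of the Marchenko-Pastur law *)

Section FreePoissonLaw.
Context {R : realType}.
Implicit Types (q : R) (nu : probability (measurableTypeR R) R).

Lemma continuous_exp n : continuous (fun t : R => t ^+ n).
Proof. exact: exprn_continuous. Qed.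

Definition mp_integral q nu := forall F : R -> R, continuous F ->
  nu.-integrable setT (EFin \o F) /\
  \int[nu]_t F t =
    int0pi (fun x => F (mp_point q x) * mp_density q x) + (1 - mp_mass q) * F 0.

(** In the angle variable [2 / pi * sin^2] is the semicircle weight, and [sin x sin ((n + 1) x)]
    brings in its orthogonal polynomials. Multiplication by [mp_point] acts on them by a three-term
    recurrence, which the factor [q ^+ n] in [f] scales to the form with [r0 = 1 + q ^+ 2] and
    [r1 = q ^+ 2]. *)
Lemma semicircle_moments q (w : nat -> R) :
  (forall n, w n = 2 / pi * int0pi (fun x => mp_point q x ^+ n * sin x ^+ 2)) ->
  w 0 = 1 /\ (forall n, w n.+1 =
     (1 + q ^+ 2) * w n + q ^+ 2 * \sum_(i < n) w i * w (n.-1 - i)%N).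
Proof.
move=> wE; have pi0 : pi != 0 :> R by rewrite gt_eqF ?pi_gt0.
have cS k : continuous (fun x => sin x * sin (k * x) : R).
  by move=> x; apply: cvgM; [exact: continuous_sin|exact: continuous_sin_mul].
have cX n : continuous (fun x => mp_point q x ^+ n).
  move=> x; apply: (@continuous_comp _ _ _ (mp_point q) (fun t => t ^+ n)).
    exact: continuous_mp_point.
  exact: continuous_exp.
have cXS n k : continuous (fun x => mp_point q x ^+ n * (sin x * sin (k * x))).
  by move=> x; apply: cvgM; [exact: cX|exact: cS].
pose f m n := 2 / pi * q ^+ n * int0pi (fun x => mp_point q x ^+ m * (sin x * sin (n.+1%:R * x))).
have wf n : w n = f n 0.
  rewrite wE /f expr0 mulr1; congr (_ * _); apply: eq_int0pi => x.
  by rewrite mul1r expr2.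
have f0 n : f 0 n = (n == 0%N)%:R.
  rewrite /f (eq_int0pi _ (fun x => sin x * sin (n.+1%:R * x))) => [|x]; last first.
    by rewrite expr0 mul1r.
  rewrite int0pi_sin_sin; case: n => [|n] /=; last by rewrite mul0r mulr0.
  by rewrite expr0 mulr1 mul1r; move: (@pi R) pi0 => P P0; field; rewrite P0.
have fS m n : f m.+1 n = f m n.+1 + (1 + q ^+ 2) * f m n +
    q ^+ 2 * (if n is n'.+1 then f m n' else 0).
  pose I k := int0pi (fun x => mp_point q x ^+ m * (sin x * sin (k%:R * x))).
  have -> : f m.+1 n = 2 / pi * q ^+ n * (q * I n.+2 + ((1 + q ^+ 2) * I n.+1 + q * I n)).
    have cZ l k := continuousZ _ l (cXS m k).
    have cZD l k l' k' : continuous (fun x =>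
        l * (mp_point q x ^+ m * (sin x * sin (k * x))) +
        l' * (mp_point q x ^+ m * (sin x * sin (k' * x)))).
      by move=> x; apply: cvgD; [exact: cZ|exact: cZ].
    rewrite /f; congr (_ * _); rewrite /I -!int0piZ // -!int0piD //.
    apply: eq_int0pi => x.
    have -> : sin (n.+2%:R * x) = 2 * cos x * sin (n.+1%:R * x) - sin (n%:R * x).
      by rewrite -sin_sum_rec addrK.
    rewrite exprS {1}/mp_point; move: (mp_point q x ^+ m) (sin (n.+1%:R * x)) (sin (n%:R * x)).
    by move=> M s1 s0; ring.
  case: n => [|n]; last by rewrite /f -/(I n.+1) -/(I n.+2) -/(I n.+3) !exprS; ring.
  have I0 : I 0 = 0.
    rewrite /I (eq_int0pi _ (fun x => 0 * (mp_point q x ^+ m * (sin x * sin (0%:R * x))))).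
      by rewrite int0piZ ?mul0r.
    by move=> x; rewrite !mul0r sin0 !mulr0.
  by rewrite I0 /f -/(I 1) -/(I 2) expr0 expr1; ring.
split; first by rewrite wf f0.
move=> n; rewrite !wf (semicircular_appell_moments _ _ f0 _ _ fS).
by congr (_ + _ * _); apply: eq_bigr => i _; rewrite !wf.
Qed.

(** Moments of positive order do not see the atom, and by [mp_densityM] they are [q ^+ 2] times
    semicircular moments of order one less. *)
Lemma mp_moments q nu : 0 < q -> mp_integral q nu ->
  (\int[nu]_t (t ^+ 0) = 1) /\
  (forall n, \int[nu]_t (t ^+ n.+1) = q ^+ 2 * \int[nu]_t (t ^+ n) +
     \sum_(i < n) (\int[nu]_t (t ^+ i.+1)) * (\int[nu]_t (t ^+ (n.-1 - i)))).
Proof.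
move=> q0 nuP.
pose w n := 2 / pi * int0pi (fun x => mp_point q x ^+ n * sin x ^+ 2).
have [w0 wS] := semicircle_moments q w (fun=> erefl).
have m0 : \int[nu]_t (t ^+ 0) = 1.
  rewrite (nuP _ (continuous_exp 0)).2 (eq_int0pi _ (mp_density q)) => [|x]; last first.
    by rewrite expr0 mul1r.
  by rewrite int0pi_mp_density // expr0 mulr1 addrC subrK.
have mS n : \int[nu]_t (t ^+ n.+1) = q ^+ 2 * w n.
  rewrite (nuP _ (continuous_exp n.+1)).2 expr0n mulr0 addr0 /w mulrA -int0piZ.
    apply: eq_int0pi => x; rewrite exprSr -mulrA [_ * mp_density _ _]mulrC.
    by rewrite mp_densityM //; ring.
  move=> x; apply: cvgM; last exact: continuous_sin2.
  apply: (@continuous_comp _ _ _ (mp_point q) (fun t => t ^+ n)).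
    exact: continuous_mp_point.
  exact: continuous_exp.
split=> // n.
exact: (free_poisson_moments_of_semicircular _ _ w (fun n => \int[nu]_t (t ^+ n)) w0 wS m0 mS).
Qed.

Lemma mp_free_poisson q nu : 0 < q -> mp_integral q nu -> free_poisson (q ^+ 2) nu.
Proof.
move=> q0 nuP; split; first by rewrite exprn_gt0.
have [m0 mS] := mp_moments q nu q0 nuP.
exists (fun=> q ^+ 2).
  move=> n; split; first exact: (nuP _ (continuous_exp n)).1.
  have := nc_partition_sum n _ (q ^+ 2) _ m0 mS [set: 'I_n]%SET.
  rewrite cardsT card_ord => <-; apply: eq_bigr => P _.
  by rewrite prodr_const.
near=> z; apply: cvg_geometric_series; near: z.
by apply: (@nbhs0_lt R R^o); exact: ltr01.
Unshelve. all: by end_near.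
Qed.

Lemma affine_law nu (alpha beta : R) :
  exists nu' : probability (measurableTypeR R) R,
    (forall B : set R, measurable B ->
      nu' B = nu ((fun t => alpha * t + beta) @^-1` B)) /\
    forall F : R -> R, continuous F ->
      nu.-integrable setT (EFin \o (fun t => F (alpha * t + beta))) ->
      nu'.-integrable setT (EFin \o F) /\
      \int[nu']_t F t = \int[nu]_t F (alpha * t + beta).
Proof.
pose g (t : R) := alpha * t + beta.
have cg : continuous g.
  move=> x; apply: cvgD; last exact: cvg_cst.
  by apply: cvgM; [exact: cvg_cst|exact: cvg_id].
have mg : @measurable_fun _ _ (measurableTypeR R) (measurableTypeR R) setT g.
  exact: continuous_measurable_fun cg.
pose X : {mfun (measurableTypeR R) >-> (measurableTypeR R)} :=
  @mfun_Sub _ _ (measurableTypeR R) (measurableTypeR R) g (mem_set mg).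
exists (distribution nu X); split=> // F cF iF.
have mF : measurable_fun setT F by exact: continuous_measurable_fun.
split; first by apply: integrable_pushforward => //; exact/measurable_EFinP.
by rewrite /Rintegral integral_distribution //; exact/measurable_EFinP.
Qed.

End FreePoissonLaw.

(** * Cauchy transform of the standardized law *)

Section MeixnerCauchy.
Context {R : realType}.
Implicit Types (z k : R[i]) (q : R) (nu mu : probability (measurableTypeR R) R).

(** Both roots have positive real part and an imaginary part with the sign of [b]. The sum is the
    real inner product of the roots, so their difference is shorter than their sum. *)
Lemma sqrtc_same_quadrant (a a' b : R) : b != 0 ->
  0 < complex.Re (sqrtc (a +i* b)) * complex.Re (sqrtc (a' +i* b)) +
      complex.Im (sqrtc (a +i* b)) * complex.Im (sqrtc (a' +i* b)).
Proof.
move=> b0 /=; rewrite (negbTE b0).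
have pos c : 0 < Num.sqrt (c ^+ 2 + b ^+ 2) + c.
  have lt : `|c| < Num.sqrt (c ^+ 2 + b ^+ 2).
    rewrite -sqrtr_sqr ltr_sqrt ?ltrDl ?exprn_even_gt0 //.
    by rewrite ltr_pwDr ?exprn_even_gt0 ?sqr_ge0.
  by move: lt; rewrite ltr_norml => /andP[+ _]; lra.
apply: ltr_pwDl.
  by rewrite mulr_gt0 // sqrtr_gt0 divr_gt0.
rewrite mulrACA -expr2 mulr_ge0 ?sqr_ge0 // mulr_ge0 // sqrtr_ge0.
Qed.

(** In terms of [p = sqrtc (z - 2)] and [r = sqrtc (z + 2)] one has [w = ((r - p) / 2)^2] and
    [(r - p) (r + p) = 4]. Hence [1 / w = ((r + p) / 2)^2], so [w + 1 / w = z], and [|w| < 1]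
    amounts to [|r - p| < |r + p|]: the product of principal roots selects the right branch. *)
Lemma semicircle_root z : complex.Im z != 0 ->
  let w := (z - sqrtc (z - 2) * sqrtc (z + 2)) / 2 in
  w ^+ 2 - z * w + 1 = 0 /\ `|w| < 1.
Proof.
move=> z0 w; pose p := sqrtc (z - 2); pose r := sqrtc (z + 2).
have p2 : p ^+ 2 = z - 2 by rewrite sqr_sqrtc.
have r2 : r ^+ 2 = z + 2 by rewrite sqr_sqrtc.
have zE : z = (p ^+ 2 + r ^+ 2) / 2 by rewrite p2 r2; field.
have pr4 : (r - p) * (r + p) = 4.
  have -> : (r - p) * (r + p) = r ^+ 2 - p ^+ 2 by ring.
  by rewrite p2 r2; ring.
have wE : w = ((r - p) / 2) ^+ 2 by rewrite /w -/p -/r zE; field.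
split.
  rewrite wE; set u := (r - p) / 2; set v := (r + p) / 2.
  have uv : u * v = 1.
    by rewrite /u /v mulrACA pr4; field.
  have -> : z = u ^+ 2 + v ^+ 2 by rewrite zE /u /v; field.
  have -> : (u ^+ 2) ^+ 2 - (u ^+ 2 + v ^+ 2) * u ^+ 2 + 1 = 1 - (u * v) ^+ 2 by ring.
  by rewrite uv expr1n subrr.
have lt : `|r - p| < `|r + p|.
  rewrite -(@ltr_pXn2r _ 2) ?nnegrE // -!add_Re2_Im2 ltcR.
  have := @sqrtc_same_quadrant (complex.Re z - 2) (complex.Re z + 2) (complex.Im z) z0.
  have -> : (complex.Re z - 2) +i* complex.Im z = z - 2.
    case: (z) => a b; apply/eqP; rewrite eq_complex /=; apply/andP; split; apply/eqP; ring.
  have -> : (complex.Re z + 2) +i* complex.Im z = z + 2.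
    by case: (z) => a b; apply/eqP; rewrite eq_complex /=; apply/andP; split; apply/eqP; ring.
  rewrite -/p -/r; case: (p) (r) => [a b] [c d] /= h.
  by nra.
rewrite wE normrX expr_lt1 // normrM normfV [`|2|]ger0_norm //.
have lt2 : `|r - p| ^+ 2 < 2 ^+ 2.
  have -> : 2 ^+ 2 = `|r - p| * `|r + p| :> R[i].
    by rewrite -normrM pr4 ger0_norm //; ring.
  rewrite expr2 ltr_pM2l //.
  rewrite normr_gt0; apply: contraTneq lt => rp0.
  move: pr4; rewrite rp0 mul0r => /eqP; by rewrite eq_sym pnatr_eq0.
by rewrite ltr_pdivrMr // mul1r; move: lt2; rewrite ltr_pXn2r ?nnegrE.
Qed.

Lemma continuous_Re_resolvent k z (l m : R) : complex.Im z != 0 ->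
  continuous (fun t : R => complex.Re (k / (z - (l * t + m)%:C))).
Proof.
move=> z0; pose u (t : R) := complex.Re z - m + (- l) * t.
rewrite (_ : (fun t => _) = fun t => complex.Re (k / (u t +i* complex.Im z))); last first.
  apply/funext => t; congr (complex.Re (_ / _)); case: z {z0} @u => a b /=.
  by apply/eqP; rewrite eq_complex /=; apply/andP; split; apply/eqP; ring.
apply: (@continuous_Re_div _ k u (fun=> complex.Im z)) => [x|x|x].
- apply: cvgD; first exact: cvg_cst.
  by apply: cvgM; [exact: cvg_cst|exact: cvg_id].
- exact: cvg_cst.
- by rewrite eq_complex /= negb_and z0 orbT.
Qed.

Lemma subC_real_neq0 z (t : R) : complex.Im z != 0 -> z - t%:C != 0.
Proof. by case: z => a b /= b0; rewrite eq_complex /= oppr0 addr0 negb_and b0 orbT. Qed.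

(** For [y = q^-1 * mp_point q x - q = q^-1 + 2 cos x] the difference [z - y] is [zeta - 2 cos x].
    The solution [w] of [w + 1 / w = zeta] in the unit disc turns it into [cos_den w x / w], which
    [int0pi_resolvent] integrates. *)
Lemma mp_resolvent q nu k z : 0 < q -> mp_integral q nu -> complex.Im z != 0 ->
  let zeta := z - (q^-1)%:C in
  \int[nu]_t complex.Re (k / (z - (q^-1 * t - q)%:C)) =
  complex.Re (k * (1 + q%:C * ((zeta - sqrtc (zeta - 2) * sqrtc (zeta + 2)) / 2))
              / (z + q%:C)).
Proof.
move=> q0 nuP z0 zeta; set w := (_ / 2).
have zeta0 : complex.Im zeta != 0.
  by rewrite /zeta; case: (z) z0 => a b /=; rewrite oppr0 addr0.
have [weq w1] := semicircle_root zeta zeta0; rewrite -/w in weq w1.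
have wn0 : w != 0.
  by apply/eqP => w0; move: weq; rewrite w0 mulr0 subr0 expr0n add0r => /eqP; rewrite oner_eq0.
have zq0 : z + q%:C != 0.
  by rewrite -[q%:C]opprK -rmorphN subC_real_neq0.
pose F (t : R) := complex.Re (k / (z - (q^-1 * t + (- q))%:C)).
have cF : continuous F by exact: continuous_Re_resolvent.
rewrite (nuP F cF).2.
pose k' := k / (z + q%:C).
(* The atom contributes the share of [Re k'] that the density part leaves open, so [mp_mass] cancels
   in the end. *)
have F0 : F 0 = complex.Re k' by rewrite /F mulr0 add0r rmorphN opprK.
have pi0 : pi != 0 :> R by rewrite gt_eqF ?pi_gt0.
have qn0 : q != 0 by rewrite gt_eqF.
(* This form never divides by mp_point, which may vanish. *)
have kE (y : R) : k / (z - y%:C) = k' + (y + q)%:C * (k' / (z - y%:C)).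
  have zy := subC_real_neq0 z y z0; have -> : (y + q)%:C = y%:C + q%:C by rewrite rmorphD.
  rewrite /k'.
  by move: (y%:C) (q%:C) zy zq0 => y' q' zy' zq'; field; rewrite zq' zy'.
have Fmp x : F (mp_point q x) * mp_density q x =
    complex.Re k' * mp_density q x +
    2 / pi * q * (sin x ^+ 2 * complex.Re (k' * w / cos_den w x)).
  pose y := q^-1 * mp_point q x - q.
  have yE : y = q^-1 + 2 * cos x by rewrite /y /mp_point; field.
  have zy : z - y%:C = cos_den w x / w.
    apply: (mulIf wn0); rewrite divfK // /cos_den yE.
    have -> : z - (q^-1 + 2 * cos x)%:C = zeta - 2 * (cos x)%:C.
      by rewrite /zeta rmorphD rmorphM rmorph_nat opprD addrA.
    have -> : w ^+ 2 = zeta * w - 1 by apply/eqP; rewrite -subr_eq0 opprB addrA addrAC weq.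
    by ring.
  have zy0 : z - y%:C != 0 by exact: subC_real_neq0.
  have d0 : cos_den w x != 0 by exact: cos_den_neq0.
  have yq : (y + q) * mp_density q x = 2 / pi * q * sin x ^+ 2.
    have -> : y + q = q^-1 * mp_point q x by rewrite /y subrK.
    rewrite -mulrA [mp_point q x * _]mulrC mp_densityM //.
    by move: (@pi R) pi0 => P P0; field; rewrite P0 qn0.
  have kw : k' / (z - y%:C) = k' * w / cos_den w x by rewrite zy invf_div mulrA.
  have -> : F (mp_point q x) = complex.Re k' + (y + q) * complex.Re (k' * w / cos_den w x).
    by rewrite /F -/y kE kw -Re_realM; case: (k') (_ * _) => [? ?] [? ?].
  by rewrite mulrDl mulrAC yq; ring.
have cd := continuous_mp_density q q0; have cdZ l := continuousZ _ l cd.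
have cr : continuous (fun x => sin x ^+ 2 * complex.Re (k' * w / cos_den w x)).
  by move=> x; apply: cvgM; [exact: continuous_sin2|exact: continuous_cos_den].
have crZ l := continuousZ _ l cr.
rewrite (eq_int0pi _ _ Fmp) int0piD ?int0piZ ?int0pi_resolvent ?int0pi_mp_density //.
rewrite F0.
have -> : k * (1 + q%:C * w) / (z + q%:C) = k' + q%:C * (k' * w).
  by rewrite /k'; field.
have -> : complex.Re (k' + q%:C * (k' * w)) = complex.Re k' + q * complex.Re (k' * w).
  by rewrite -Re_realM; case: (k') (q%:C * _) => [? ?] [? ?].
move: (complex.Re k') (complex.Re (k' * w)) (mp_mass q) (@pi R) pi0 => A B m P P0.
by field; rewrite P0.
Qed.

(** Mean and variance of the free Poisson law are both [q ^+ 2], so [t / q - q] standardizes it. *)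
Lemma mp_free_meixner q nu : 0 < q -> mp_integral q nu ->
  exists mu, (forall B : set R, measurable B ->
      mu B = nu ((fun t => q^-1 * t + - q) @^-1` B)) /\
    (forall F : R -> R, continuous F ->
      nu.-integrable setT (EFin \o (fun t => F (q^-1 * t + - q))) ->
      mu.-integrable setT (EFin \o F) /\
      \int[mu]_t F t = \int[nu]_t F (q^-1 * t + - q)) /\
    free_meixner q^-1 mu.
Proof.
move=> q0 nuP; have [mu [muB muP]] := affine_law nu q^-1 (- q).
exists mu; split=> //; split=> // z z0.
have ReP k : \int[mu]_t complex.Re (k / (z - t%:C)) =
    \int[nu]_t complex.Re (k / (z - (q^-1 * t - q)%:C)).
  have cF : continuous (fun t : R => complex.Re (k / (z - t%:C))).
    rewrite (_ : (fun t => _) = fun t : R => complex.Re (k / (z - (1 * t + 0)%:C))).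
      exact: continuous_Re_resolvent.
    by apply/funext => t; rewrite mul1r addr0.
  have [] := muP _ cF; last by move=> _ ->.
  exact: (nuP _ (continuous_Re_resolvent k z q^-1 (- q) z0)).1.
(* Rotation by [-i] makes the imaginary part a real part; the free factor [k] in [mp_resolvent] thus
   yields both coordinates. *)
have ImE (u : R[i]) : complex.Im u = complex.Re (- 'i%C * u).
  by case: u => a b /=; rewrite oppr0 mul0r mulN1r opprK add0r.
set zeta := z - (q^-1)%:C; set s := sqrtc _ * sqrtc _.
pose c := (1 + q%:C * ((zeta - s) / 2)) / (z + q%:C).
have qn0 : q != 0 by rewrite gt_eqF.
have qC0 : q%:C != 0 :> R[i] by rewrite eq_complex /= eqxx andbT.
have zq0 : z + q%:C != 0 by rewrite -[q%:C]opprK -rmorphN subC_real_neq0.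
have -> : cauchy_transform mu z = c.
  have cE k : \int[mu]_t complex.Re (k / (z - t%:C)) = complex.Re (k * c).
    rewrite ReP mp_resolvent //; congr complex.Re; exact: esym (mulrA _ _ _).
  have ext (u v : R[i]) : complex.Re u = complex.Re v -> complex.Im u = complex.Im v -> u = v.
    by case: u v => [? ?] [? ?] /= -> ->.
  apply: ext; rewrite [X in X = _]/=.
    rewrite -[c]mul1r -cE; apply: eq_Rintegral => t _.
    by rewrite div1r.
  rewrite ImE -cE; apply: eq_Rintegral => t _.
  by rewrite ImE.
have -> : (q^-1)%:C = (q%:C)^-1 :> R[i] by rewrite fmorphV.
rewrite /c /zeta fmorphV; field.
by apply/andP.
Qed.

End MeixnerCauchy.

(** * From moment recurrences to the laws of random variables *)

Section LawOfRandomVariable.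
Context {R : realType} {A : algType R[i]}.
Variable tau : {scalar A}.
Implicit Types (mu nu : probability (measurableTypeR R) R).

Lemma strictly_positive_tau_gt0 (x : A) : strictly_positive tau x -> 0 < tau x.
Proof.
case=> mu [/(_ 1) [imu tx] [c [d [c0 mucd]]]].
rewrite expr1 in tx; rewrite tx -[0]/(0%:C) ltcR.
pose I : set R := `[c, d]%classic.
have muI : mu I = 1%E := mucd.
have mI : measurable (I : set (measurableTypeR R)) by exact: measurable_itv.
have mIC : measurable (~` I : set (measurableTypeR R)) by exact: measurableC.
have muIC : mu (~` I) = 0%E.
  by rewrite probability_setC // muI subee.
have -> : \int[mu]_t (t ^+ 1) = \int[mu]_(t in I) (t ^+ 1).
  rewrite /Rintegral (negligible_integral mIC measurableT imu muIC).
  by rewrite setTD setCK.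
apply: (lt_le_trans c0).
have -> : c = \int[mu]_(t in I) c.
  have -> : \int[mu]_(t in I) c = c * fine (mu I) by exact: Rintegral_cst.
  by rewrite muI mulr1.
apply: le_Rintegral => //.
- apply: (@integrableS _ _ _ mu setT) => //.
  exact: finite_measure_integrable_cst.
- exact: integrableS imu.
- by move=> t; rewrite /I /= in_itv /= expr1 => /andP[].
Qed.

(** Dilation by [c] multiplies the moment of order [n] by [c ^+ n] and so changes the coefficients
    [q ^+ 2] and 1 of the recurrence into [c q^2 = m] and [c]. *)
Lemma mp_law_rv (x : A) (c m : R) : 0 < c -> 0 < m -> tau 1 = 1 ->
  (forall n, tau (x ^+ n.+1) = m%:C * tau (x ^+ n)
      + c%:C * \sum_(i < n) tau (x ^+ i.+1) * tau (x ^+ (n.-1 - i))) ->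
  exists nu q, [/\ 0 < q, q ^+ 2 = m / c, mp_integral q nu &
    forall n, tau (x ^+ n) = (\int[nu]_t ((c * t) ^+ n))%:C].
Proof.
move=> c0 m0 tau1 xS; pose q := Num.sqrt (m / c).
have q0 : 0 < q by rewrite sqrtr_gt0 divr_gt0.
have q2 : q ^+ 2 = m / c by rewrite sqr_sqrtr // divr_ge0 // ltW.
have [nu nuP] := mp_law q q0; exists nu, q; split=> //.
have [M0 MS] := mp_moments q nu q0 nuP.
pose M n := \int[nu]_t (t ^+ n).
have cM n : \int[nu]_t ((c * t) ^+ n) = c ^+ n * M n.
  rewrite -RintegralZl //; last exact: (nuP _ (continuous_exp n)).1.
  by apply: eq_Rintegral => t _; rewrite exprMn.
move=> n; rewrite cM; move: n.
apply: (eq_quadratic_recurrence _ m%:C c%:C) => //.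
  by rewrite !expr0 tau1 /M M0 mulr1.
move=> n; rewrite /M MS -/(M n) q2.
have -> : c ^+ n.+1 * (m / c * M n + \sum_(i < n) M i.+1 * M (n.-1 - i)%N) =
    m * (c ^+ n * M n) + c * \sum_(i < n) (c ^+ i.+1 * M i.+1) * (c ^+ (n.-1 - i) * M (n.-1 - i)%N).
  rewrite mulrDr; congr (_ + _); first by rewrite exprS; field; rewrite gt_eqF.
  rewrite !mulr_sumr; apply: eq_bigr => i _.
  have -> : c ^+ n.+1 = c * (c ^+ i.+1 * c ^+ (n.-1 - i)).
    rewrite -exprD -exprS; congr (_ ^+ _.+1).
    by case: n i => [[]//|n] i /=; rewrite addSn subnKC // -ltnS.
  by ring.
rewrite rmorphD !rmorphM rmorph_sum; congr (_ + _ * _).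
by apply: eq_bigr => i _; rewrite rmorphM.
Qed.

Lemma tau_affine_power (x : A) nu (c l b : R) :
  (forall F : R -> R, continuous F -> nu.-integrable setT (EFin \o F)) ->
  (forall n, tau (x ^+ n) = (\int[nu]_t ((c * t) ^+ n))%:C) ->
  forall n, tau ((l%:C *: (x + b%:C *: 1)) ^+ n) =
            (\int[nu]_t ((l * (c * t + b)) ^+ n))%:C.
Proof.
move=> inu xn n.
have ca (b' : R) : continuous (fun t : R => c * t + b').
  move=> t; apply: cvgD; last exact: cvg_cst.
  by apply: cvgM; [exact: cvg_cst|exact: cvg_id].
have cX (b' : R) k : continuous (fun t : R => (c * t + b') ^+ k).
  move=> t; apply: (@continuous_comp _ _ _ (fun t => c * t + b') (fun t => t ^+ k)).
    exact: ca.
  exact: continuous_exp.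
have cXX k j : continuous (fun t : R => (c * t) ^+ k * (c * t + b) ^+ j).
  have c0 : continuous (fun t : R => (c * t) ^+ k).
    rewrite (_ : (fun t => _) = fun t => (c * t + 0) ^+ k); first exact: cX.
    by apply/funext => t; rewrite addr0.
  by move=> t; apply: cvgM; [exact: c0|exact: cX].
(* The extra power of [x] replaces the binomial formula: one factor [x + b] splits the claim into
   the cases [k.+1] and [k] for a smaller [n]. *)
suff H k : tau (x ^+ k * (x + b%:C *: 1) ^+ n) =
           (\int[nu]_t ((c * t) ^+ k * (c * t + b) ^+ n))%:C.
  have := H 0; rewrite expr0 mul1r => e; rewrite exprZn linearZ /= e.
  rewrite -rmorphXn -rmorphM -RintegralZl //; last exact: inu.
  by congr (_%:C); apply: eq_Rintegral => t _; rewrite expr0 mul1r exprMn.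
elim: n k => [|n IH] k.
  rewrite expr0 mulr1 xn; congr (_%:C); apply: eq_Rintegral => t _.
  by rewrite expr0 mulr1.
rewrite exprS mulrA mulrDr -scalerAr mulr1 -exprSr mulrDl -scalerAl linearD linearZ /= !IH.
rewrite -rmorphM -rmorphD -RintegralZl //; last exact: inu.
rewrite -RintegralD //; [|exact: inu|apply: inu]; last first.
  by apply: (continuousZ _ b); exact: cXX.
congr (_%:C); apply: eq_Rintegral => t _.
by rewrite exprS [(c * t + b) ^+ n.+1]exprS; ring.
Qed.

Lemma mp_law_free_poisson_type (x : A) nu (q c : R) : 0 < q -> mp_integral q nu ->
  (forall n, tau (x ^+ n) = (\int[nu]_t ((c * t) ^+ n))%:C) ->
  exists2 mu, is_law tau x mu & free_poisson_type mu.
Proof.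
move=> q0 nuP xn; have [mu [muB muP]] := affine_law nu c 0.
exists mu; last first.
  exists (q ^+ 2), nu, c, 0; split=> //; exact: mp_free_poisson.
move=> n; have [|imu ->] := muP _ (continuous_exp n).
  apply: (nuP (fun t => (c * t + 0) ^+ n) _).1 => t.
  apply: (@continuous_comp _ _ _ (fun t => c * t + 0) (fun t => t ^+ n)).
    apply: cvgD; last exact: cvg_cst.
    by apply: cvgM; [exact: cvg_cst|exact: cvg_id].
  exact: continuous_exp.
split=> //; rewrite xn; congr (_%:C).
by apply: eq_Rintegral => t _; rewrite addr0.
Qed.

(** Since [m = c q^2], the standard deviation is [c q], so [(c t - m) / (c q) = t / q - q] and the
    Meixner parameter is [c q / m = 1 / q]. *)
Lemma mp_law_standardize (x : A) nu (q c m : R) : 0 < q -> 0 < c -> 0 < m ->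
  q ^+ 2 = m / c -> mp_integral q nu ->
  (forall n, tau (x ^+ n) = (\int[nu]_t ((c * t) ^+ n))%:C) ->
  tau x = m%:C -> variance_rv tau x = c * m ->
  exists2 mu, is_law tau (standardize tau x) mu &
    free_meixner (Num.sqrt (variance_rv tau x) / mean tau x) mu.
Proof.
move=> q0 c0 m0 q2 nuP xn tx vx.
have mE : m = c * q ^+ 2 by rewrite q2; field; rewrite gt_eqF.
have sE : Num.sqrt (variance_rv tau x) = c * q.
  rewrite vx mE (_ : c * (c * q ^+ 2) = (c * q) ^+ 2); last by ring.
  by rewrite sqrtr_sqr ger0_norm // mulr_ge0 // ltW.
have meanE : mean tau x = m by rewrite /mean tx.
have [mu [_ [muP meix]]] := mp_free_meixner q nu q0 nuP.
exists mu; last first.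
  rewrite sE meanE mE (_ : c * q / (c * q ^+ 2) = q^-1) //.
  by field; rewrite !gt_eqF.
have caff : continuous (fun t : R => q^-1 * t + - q).
  move=> t; apply: cvgD; last exact: cvg_cst.
  by apply: cvgM; [exact: cvg_cst|exact: cvg_id].
move=> n; have [|imu ->] := muP _ (continuous_exp n).
  apply: (nuP (fun t => (q^-1 * t + - q) ^+ n) _).1 => t.
  apply: (@continuous_comp _ _ _ (fun t => q^-1 * t + - q) (fun t => t ^+ n)).
    exact: caff.
  exact: continuous_exp.
split=> //; rewrite /standardize sE meanE -scaleNr -rmorphN.
rewrite (tau_affine_power _ nu c) //; last by move=> F /nuP[].
congr (_%:C); apply: eq_Rintegral => t _; congr (_ ^+ _).
by rewrite mE; field; rewrite !gt_eqF.
Qed.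

End LawOfRandomVariable.

Theorem proposition3p5 (R : realType) (H : completeNormedModType R[i])
    (dot : {dot H for (@Num.conj R[i])})
    (A : algType R[i]) (star : A -> A) (rep : A -> H -> H) (tau : {scalar A})
    (hA : von_neumann_algebra dot star rep)
    (htau : normal_faithful_tracial_state dot star rep tau)
    (X Y : A) (hX : self_adjoint star X) (hY : self_adjoint star Y)
    (ndX : nondegenerate_rv X) (ndY : nondegenerate_rv Y)
    (freeXY : free_rv tau X Y)
    (posS : strictly_positive tau (X + Y))
    (T : A) (hT : is_inv_sqrt dot rep (X + Y) T)
    (freeZS : free_rv tau (T * X * T) (X + Y)) :
  [/\ exists2 mu, is_law tau X mu & free_poisson_type mu,
      exists2 mu, is_law tau Y mu & free_poisson_type mu,
      0 < tau X
    & exists2 mu, is_law tau (standardize tau X) mu &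
        free_meixner (Num.sqrt (variance_rv tau X) / mean tau X) mu].
Proof.
have tau1 := state_one htau; have [_ T2S ST2] := hT.
have S0 := strictly_positive_tau_gt0 _ _ posS.
have [c [m [m' [c0 m0 m'0 Xn Yn]]]] := lukacs_moments _ _ _ _ hA htau _ _ _
  hX hY ndX ndY freeXY S0 T2S ST2 freeZS.
have [nu [q [q0 q2 nuP nuX]]] := mp_law_rv _ _ _ _ c0 m0 tau1 Xn.
have [nu' [q' [q'0 _ nuP' nuY]]] := mp_law_rv _ _ _ _ c0 m'0 tau1 Yn.
have tX : tau X = m%:C.
  by have := Xn 0; rewrite expr1 expr0 tau1 big_ord0 mulr0 addr0 mulr1.
(* At [n = 1] the recurrence reads [tau (X ^+ 2) = m * m + c * m]. *)
have vX : variance_rv tau X = c * m.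
  rewrite /variance_rv /mean Xn big_ord1 expr1 /= expr0 tau1 tX mulr1.
  by rewrite -!rmorphM -rmorphD /= expr2; ring.
split.
- exact: (mp_law_free_poisson_type tau X nu q c q0 nuP nuX).
- exact: (mp_law_free_poisson_type tau Y nu' q' c q'0 nuP' nuY).
- by rewrite tX -[0]/(0%:C) ltcR.
- exact: (mp_law_standardize tau X nu q c m).
Qed.
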